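(* Let $d\in\mathbb N$, $\alpha,\beta,\gamma,\tau>0$, $\Omega=\mathbb T^d$, and let $L,m_0,\delta>0$ be constants. Let $\mathcal M:\mathbb R\to\mathbb R_+$ and $\Pi:\mathbb R\to\mathbb R$ be $C^\infty$ functions such that for all $h\in[0,\infty)$: $|\mathcal M'(h)|<L$, $\mathcal M(h)>1/m_0>0$, $|\Pi'(h)|<L$, $|\Pi''(h)|<L$, and $\Pi'(h)\ge\delta$. Let $W$ satisfy $W'=\Pi$. Then the system $$h_t+\nabla\cdot\mathbf q=0,\quad \tfrac1\alpha\psi_t+\nabla\cdot\mathbf q=-w,\quad \tau\mathbf q_t+\nabla(\Pi(h)+\psi)=-\frac{\mathbf q}{\mathcal M(h)},\quad \beta w_t-\gamma\nabla\cdot\mathbf p=\psi,\quad \mathbf p_t-\nabla w=0$$ for $\mathbf U=(h,\psi,\mathbf q,w,\mathbf p)^\top\in\mathcal U$ has an entropy/entropy-flux pair $(E^{\alpha,\tau},\mathbf Q^{\alpha,\tau})$ with strictly convex entropy $E^{\alpha,\tau}$, given by $$E^{\alpha,\tau}(\mathbf U)=W(h)+\frac{\psi^2}{2\alpha}+\frac{\tau|\mathbf q|^2}2+\frac{\beta w^2}2+\frac{\gamma|\mathbf p|^2}2,\qquad \mathbf Q^{\alpha,\tau}(\mathbf U)=(\Pi(h)+\psi)\mathbf q-\gamma w\,\mathbf p .$$ In particular, for any $t\in(0,T]$, under periodic boundary conditions, a classical solution $\mathbf U=(h,\psi,\mathbf q,w,\mathbf p)^\top$ of the system on $\Omega\times[0,T]$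 with values in $\mathcal U$ and initial data $(h_0,\psi_0,\mathbf q_0,w_0,\mathbf p_0)$ satisfies $$\int_\Omega\Big(W(h)+\frac{\psi^2}{2\alpha}+\frac{\tau|\mathbf q|^2}2+\frac{\beta w^2}2+\frac{\gamma|\mathbf p|^2}2\Big)(\mathbf x,t)\,d\mathbf x+\int_0^t\!\!\int_\Omega\frac{|\mathbf q|^2}{\mathcal M(h)}\,d\mathbf x\,ds=\int_\Omega\Big(W(h_0)+\frac{\psi_0^2}{2\alpha}+\frac{\tau|\mathbf q_0|^2}2+\frac{\beta w_0^2}2+\frac{\gamma|\mathbf p_0|^2}2\Big)d\mathbf x .$$
   Context: State space: $\mathcal U=\{(h,\psi,\mathbf q,w,\mathbf p)^\top\in\mathbb R^{2d+3}:h>0\}$ with $h,\psi,w\in\mathbb R$, $\mathbf q,\mathbf p\in\mathbb R^d$. The system is written as a balance law $\mathbf U_t+\sum_{j=1}^d\partial_{x_j}\mathbf F_j(\mathbf U)=\mathbf S(\mathbf U)$ with ($\mathbf e_j$ the canonical basis vectors of $\mathbb R^d$) $$\mathbf F_j(\mathbf U)=\Big(q_j,\ \alpha q_j,\ \tfrac{\Pi(h)+\psi}{\tau}\mathbf e_j,\ -\tfrac\gamma\beta p_j,\ -w\,\mathbf e_j\Big)^\top,\qquad \mathbf S(\mathbf U)=\Big(0,\ -\alpha w,\ -\tfrac{\mathbf q}{\tau\mathcal M(h)},\ \tfrac\psi\beta,\ \mathbf 0_d\Big)^\top.$$ An entropy/entropy-flux pair is a pair $(E,\mathbf Q):\mathcal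 U\to\mathbb R\times\mathbb R^d$ such that $E$ is convex with positive definite Hessian $\nabla^2_{\mathbf U}E$; for all $\mathbf U\in\mathcal U$ and $j=1,\dots,d$ the compatibility condition $\nabla_{\mathbf U}E(\mathbf U)^\top D\mathbf F_j(\mathbf U)=\nabla_{\mathbf U}Q_j(\mathbf U)^\top$ holds ($D\mathbf F_j$ is the Jacobian); and $\partial_tE(\mathbf U)+\nabla\cdot\mathbf Q(\mathbf U)\le0$ holds in the sense of distributions (along classical $\mathcal U$-valued solutions $\mathbf U$ of the system). *)

(* Defs.v *)
From HB Require Import structures.
From mathcomp Require Import all_boot all_order all_algebra.
From mathcomp Require Import all_classical all_reals all_analysis.
From mathcomp Require Import zify ring lra.

Set Implicit Arguments.
Unset Strict Implicit.
Unset Printing Implicit Defensive.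
Import Order.TTheory GRing.Theory Num.Theory.
Import numFieldNormedType.Exports.
Local Open Scope classical_set_scope.
Local Open Scope ring_scope.

Section tuple_measure.
Context {disp : measure_display} {T : measurableType disp} {R : realType}.

Definition tcons n (z : T * n.-tuple T) : n.+1.-tuple T := [tuple of z.1 :: z.2].

Definition tuncons n (x : n.+1.-tuple T) : T * n.-tuple T :=
  (thead x, [tuple of behead x]).

Lemma tconsK n : cancel (@tcons n) (@tuncons n).
Proof. by move=> [a x]; congr pair; apply: val_inj. Qed.

Lemma measurable_tcons n : measurable_fun [set: T * n.-tuple T] (@tcons n).
Proof. exact: measurable_cons. Qed.

Lemma measurable_tuncons n : measurable_fun [set: n.+1.-tuple T] (@tuncons n).
Proof.
apply/measurable_fun_pair => /=; first exact: measurable_tnth.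
exact: measurable_behead.
Qed.

HB.instance Definition _ n :=
  isMeasurableFun.Build _ _ _ _ (@tcons n) (@measurable_tcons n).

Variable mu : {sigma_finite_measure set T -> \bar R}.

Definition tuple_measureS n (m : {sigma_finite_measure set (n.-tuple T) -> \bar R})
  : set (n.+1.-tuple T) -> \bar R := pushforward (mu \x m)%E (@tcons n).

Section step.
Variables (n : nat) (m : {sigma_finite_measure set (n.-tuple T) -> \bar R}).

Let mS0 : tuple_measureS m set0 = 0%E.
Proof. exact: measure0. Qed.

Let mS_ge0 A : (0 <= tuple_measureS m A)%E.
Proof. exact: measure_ge0. Qed.

Let mS_sigma_additive : semi_sigma_additive (tuple_measureS m).
Proof. exact: measure_semi_sigma_additive. Qed.

HB.instance Definition _ := isMeasure.Build _ _ _ (tuple_measureS m)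
  mS0 mS_ge0 mS_sigma_additive.

Let mS_sigma_finite : sigma_finite setT (tuple_measureS m).
Proof.
have /sigma_finiteP[F [TF ndF Foo]] := sigma_finiteT mu.
have /sigma_finiteP[G [TG ndG Goo]] := sigma_finiteT m.
exists (fun k => @tuncons n @^-1` (F k `*` G k)).
  apply/esym; rewrite -subTset => x _.
  have [k _ Fk] : (\bigcup_k F k) (tuncons x).1 by rewrite -TF.
  have [l _ Gl] : (\bigcup_k G k) (tuncons x).2 by rewrite -TG.
  exists (maxn k l) => //; split.
    by move: Fk; exact/subsetPset/ndF/leq_maxl.
  by move: Gl; exact/subsetPset/ndG/leq_maxr.
move=> k; have [mF Fk] := Foo k; have [mG Gk] := Goo k; split.
  rewrite -[X in measurable X]setTI; apply: measurable_tuncons => //.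
  exact: measurableX.
rewrite /tuple_measureS /pushforward -comp_preimage.
rewrite (_ : _ \o _ = id); last by apply/funext => z; exact: tconsK.
by rewrite preimage_id product_measure1E// lte_mul_pinfty// ge0_fin_numE.
Qed.

HB.instance Definition _ :=
  Measure_isSigmaFinite.Build _ _ _ (tuple_measureS m) mS_sigma_finite.

End step.

(* The [n]-fold product of [mu], see [tuple_measure_box]. *)
Fixpoint tuple_measure n : {sigma_finite_measure set (n.-tuple T) -> \bar R} :=
  match n with
  | 0 => @dirac _ (0.-tuple T) [tuple] R
  | n'.+1 => tuple_measureS (tuple_measure n')
  end.

End tuple_measure.

Section tuple_measure_theory.
Context {disp : measure_display} {T : measurableType disp} {R : realType}.
Variable mu : {sigma_finite_measure set T -> \bar R}.

Lemma tuple_measure_box n (A : 'I_n -> set T) :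
  (forall i, measurable (A i)) ->
  tuple_measure mu n [set x | forall i, A i (tnth x i)] =
  (\prod_(i < n) mu (A i))%E.
Proof.
elim: n A => [A _|n IH A mA].
  by rewrite big_ord0 /= diracE mem_set//= => -[].
rewrite big_ord_recl -IH//= /tuple_measureS /pushforward -product_measure1E//.
- congr (product_measure1 _ _ _); apply/seteqP; split=> [[a x] /= Ax|].
    by split=> [|i]; [exact: (Ax ord0)|rewrite /= -(tnthS a x); exact: Ax].
  move=> [a x] /= [Aa Ax] i; case: (unliftP ord0 i) => [j ->|->] //.
  by rewrite tnthS.
- have -> : [set x : n.-tuple T | forall i, A (lift ord0 i) (tnth x i)] =
    \big[setI/setT]_(i < n) (@tnth _ T ^~ i @^-1` A (lift ord0 i)).
    apply/seteqP; split=> x /=.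
      by move=> Ax; rewrite -bigcap_seq/= => i _; exact: Ax.
    by rewrite -bigcap_seq => Ax i; apply: Ax; rewrite /= mem_index_enum.
  apply: bigsetI_measurable => i _; rewrite -[X in measurable X]setTI.
  exact: measurable_tnth.
Qed.

End tuple_measure_theory.

Section calculus.
Context {R : realType}.

Section Ck.
Context {V W : normedModType R}.

Definition iter_derive (f : V -> W) (vs : seq V) : V -> W :=
  foldr (fun v g => 'D_v g) f vs.

(* [Ck_on k A f] is meant for an open set [A] and finite-dimensional [V]: all
   iterated directional derivatives of order at most [k] exist and are
   continuous at the points of [A]. *)
Definition Ck_on (k : nat) (A : set V) (f : V -> W) : Prop :=
  forall vs : seq V, (size vs <= k)%N ->
    (forall x, A x -> {for x, continuous (iter_derive f vs)}) /\
    ((size vs < k)%N -> forall x v, A x -> derivable (iter_derive f vs) x v).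

Definition smooth (f : V -> W) : Prop := forall k, Ck_on k setT f.

End Ck.

Definition basis_vec n (k : 'I_n) : 'rV[R]_n := delta_mx 0 k.

Definition grad n (f : 'rV[R]_n -> R) (x : 'rV[R]_n) : 'rV[R]_n :=
  \row_k 'D_(basis_vec k) f x.

Definition hessian n (f : 'rV[R]_n -> R) (x : 'rV[R]_n) : 'M[R]_n :=
  \matrix_(i, j) 'D_(basis_vec i) ('D_(basis_vec j) f) x.

Definition divergence n (f : 'rV[R]_n -> 'rV[R]_n) (x : 'rV[R]_n) : R :=
  \sum_j 'D_(basis_vec j) (fun y => f y 0 j) x.

(* [jacobian] of the library acts on row vectors on the right, hence the
   transposition: [(Dmx F x) i k] is the derivative of [F_i] along [e_k]. *)
Definition Dmx m n (F : 'rV[R]_m -> 'rV[R]_n) (x : 'rV[R]_m) : 'M[R]_(n, m) :=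
  (jacobian F x)^T.

Definition posdefmx n (A : 'M[R]_n) : Prop :=
  A^T = A /\ forall v : 'rV[R]_n, v != 0 -> 0 < (v *m A *m v^T) 0 0.

Definition strictly_convex_on n (A : set 'rV[R]_n) (f : 'rV[R]_n -> R) : Prop :=
  forall x y, A x -> A y -> x <> y -> forall s, 0 < s < 1 ->
    f (s *: x + (1 - s) *: y) < s * f x + (1 - s) * f y.

Definition dotp n (u v : 'rV[R]_n) : R := \sum_i u 0 i * v 0 i.

(* The Euclidean norm squared; [`|v|] is the sup norm on row vectors. *)
Definition sqnorm n (v : 'rV[R]_n) : R := dotp v v.

End calculus.

Section torus.
Context {R : realType}.

(* The flat torus is [R^d / Z^d]; functions on it are the [Z^d]-periodic
   functions on [R^d], integrated over the fundamental domain [0,1]^d. *)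
Definition periodic d (X : Type) (f : 'rV[R]_d -> X) : Prop :=
  forall x (j : 'I_d), f (x + basis_vec j) = f x.

Definition unit_cube (d : nat) : set (d.-tuple R) :=
  [set x | forall i, tnth x i \in `[0, 1]].

Definition torus_integral d (f : 'rV[R]_d -> R) : R :=
  \int[tuple_measure (@lebesgue_measure R) d]_(x in @unit_cube d)
    f (\row_i tnth x i).

Definition time_integral (a b : R) (f : R -> R) : R :=
  \int[@lebesgue_measure R]_(s in `[a, b]) f s.

Definition slab d (I : set R) : set (R * 'rV[R]_d) := [set z | I z.1].

End torus.

Section balance_laws.
Context {R : realType} {d n : nat}.
Implicit Types (U : R -> 'rV[R]_d -> 'rV[R]_n) (G : set 'rV[R]_n).
Implicit Types (F : 'I_d -> 'rV[R]_n -> 'rV[R]_n) (S : 'rV[R]_n -> 'rV[R]_n).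

Definition balance_law F S U (t : R) (x : 'rV[R]_d) : Prop :=
  'D_1 (U ^~ x) t + \sum_(j < d) 'D_(basis_vec j) (fun y => F j (U t y)) x
  = S (U t x).

(* The values of [U] outside the time interval [0,T] are irrelevant; [C^1]
   regularity is only required inside it, with continuity up to its end points. *)
Record classical_solution G
    (eqn : (R -> 'rV[R]_d -> 'rV[R]_n) -> R -> 'rV[R]_d -> Prop)
    (T : R) U : Prop := ClassicalSolution {
  sol_periodic : forall t, 0 <= t <= T -> periodic (U t) ;
  sol_continuous :
    {within slab `[0, T], continuous (fun z : R * 'rV[R]_d => U z.1 z.2)} ;
  sol_C1 : Ck_on 1 (slab `]0, T[) (fun z : R * 'rV[R]_d => U z.1 z.2) ;
  sol_range : forall t x, 0 <= t <= T -> G (U t x) ;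
  sol_eqn : forall t x, 0 < t < T -> eqn U t x }.

(* Nonnegative elements of [C_c^oo((0,T) x T^d)]. *)
Record nonneg_test_function (T : R) (phi : R -> 'rV[R]_d -> R) : Prop :=
  NonnegTestFunction {
  test_smooth : smooth (fun z : R * 'rV[R]_d => phi z.1 z.2) ;
  test_periodic : forall t, periodic (phi t) ;
  test_support : exists a b, [/\ 0 < a, b < T &
    forall t x, phi t x != 0 -> a <= t <= b] ;
  test_ge0 : forall t x, 0 <= phi t x }.

(* [d_t E(U) + div Q(U) <= 0] in the sense of distributions. *)
Definition weak_entropy_inequality (E : 'rV[R]_n -> R)
    (Q : 'rV[R]_n -> 'rV[R]_d) (T : R) U : Prop :=
  forall phi, nonneg_test_function T phi ->
    0 <= time_integral 0 T (fun t => torus_integral (fun x =>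
      E (U t x) * 'D_1 (phi ^~ x) t + dotp (Q (U t x)) (grad (phi t) x))).

Record entropy_pair G F S (E : 'rV[R]_n -> R) (Q : 'rV[R]_n -> 'rV[R]_d)
    : Prop := EntropyPair {
  entropy_C2 : Ck_on 2 G E ;
  entropy_flux_C1 : Ck_on 1 G Q ;
  entropy_convex : convex_function G (E : _ -> R^o) ;
  entropy_hessian : forall u, G u -> posdefmx (hessian E u) ;
  entropy_compat : forall u j, G u ->
    grad E u *m Dmx (F j) u = grad (fun v => Q v 0 j) u ;
  entropy_ineq : forall T U, 0 < T ->
    classical_solution G (balance_law F S) T U ->
    weak_entropy_inequality E Q T U }.

End balance_laws.

Definition sdim (d : nat) := (1 + (1 + (d + (1 + d))))%N.

Lemma sdimE d : sdim d = (2 * d + 3)%N.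
Proof. by rewrite /sdim; lia. Qed.

Section system.
Context {R : realType} {d : nat}.

Definition mkstate (h psi : R) (q : 'rV[R]_d) (w : R) (p : 'rV[R]_d)
    : 'rV[R]_(sdim d) :=
  row_mx h%:M (row_mx psi%:M (row_mx q (row_mx w%:M p))).

Definition s_h (u : 'rV[R]_(sdim d)) : R := (lsubmx u : 'rV_1) 0 0.
Definition s_psi (u : 'rV[R]_(sdim d)) : R := (lsubmx (rsubmx u) : 'rV_1) 0 0.
Definition s_q (u : 'rV[R]_(sdim d)) : 'rV[R]_d := lsubmx (rsubmx (rsubmx u)).
Definition s_w (u : 'rV[R]_(sdim d)) : R :=
  (lsubmx (rsubmx (rsubmx (rsubmx u))) : 'rV_1) 0 0.
Definition s_p (u : 'rV[R]_(sdim d)) : 'rV[R]_d :=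
  rsubmx (rsubmx (rsubmx (rsubmx u))).

Definition state_space : set 'rV[R]_(sdim d) := [set u | 0 < s_h u].

Lemma state_eqP (u v : 'rV[R]_(sdim d)) :
  u = v <-> [/\ s_h u = s_h v, s_psi u = s_psi v, s_q u = s_q v,
                s_w u = s_w v & s_p u = s_p v].
Proof.
split=> [->//|[]]; rewrite /s_h /s_psi /s_q /s_w /s_p => eh epsi eq ew ep.
have rV1 (a b : 'rV[R]_1) : a 0 0 = b 0 0 -> a = b.
  by move=> ab; apply/rowP => i; rewrite !ord1.
rewrite -[LHS]hsubmxK -[RHS]hsubmxK; congr row_mx; first exact: rV1.
rewrite -[LHS]hsubmxK -[RHS]hsubmxK; congr row_mx; first exact: rV1.
rewrite -[LHS]hsubmxK -[RHS]hsubmxK; congr row_mx => //.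
by rewrite -[LHS]hsubmxK -[RHS]hsubmxK; congr row_mx => //; exact: rV1.
Qed.

Section mkstate_proj.
Variables (h psi w : R) (q p : 'rV[R]_d).

Lemma s_h_mk : s_h (mkstate h psi q w p) = h.
Proof. by rewrite /s_h row_mxKl mxE mulr1n. Qed.

Lemma s_psi_mk : s_psi (mkstate h psi q w p) = psi.
Proof. by rewrite /s_psi row_mxKr row_mxKl mxE mulr1n. Qed.

Lemma s_q_mk : s_q (mkstate h psi q w p) = q.
Proof. by rewrite /s_q !row_mxKr row_mxKl. Qed.

Lemma s_w_mk : s_w (mkstate h psi q w p) = w.
Proof. by rewrite /s_w !row_mxKr row_mxKl mxE mulr1n. Qed.

Lemma s_p_mk : s_p (mkstate h psi q w p) = p.
Proof. by rewrite /s_p !row_mxKr. Qed.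

End mkstate_proj.

Section derivable_state.
Context {V : normedModType R}.
Implicit Types (x v : V).

Lemma derivable_row_mx m n1 n2 (f : V -> 'M[R]_(m, n1)) (g : V -> 'M[R]_(m, n2))
    x v :
  derivable f x v -> derivable g x v ->
  derivable (fun y => row_mx (f y) (g y)) x v.
Proof.
move=> /derivable_mxP df /derivable_mxP dg; apply/derivable_mxP => i j.
case: (split_ordP j) => k ->.
  rewrite (_ : (fun _ => _) = fun y => f y i k)//.
  by apply/funext => y; rewrite row_mxEl.
rewrite (_ : (fun _ => _) = fun y => g y i k)//.
by apply/funext => y; rewrite row_mxEr.
Qed.

Lemma derivable_scalar1 (f : V -> R) x v :
  derivable f x v -> derivable (fun y => (f y)%:M : 'rV[R]_1) x v.
Proof.
move=> df; apply/derivable_mxP => i j; rewrite !ord1.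
rewrite (_ : (fun _ => _) = f)//.
by apply/funext => y; rewrite mxE mulr1n.
Qed.

Lemma derivable_scale (f : V -> R) n (u : 'rV[R]_n) x v :
  derivable f x v -> derivable (fun y => f y *: u) x v.
Proof.
move=> df; apply/derivable_mxP => i j.
rewrite (_ : (fun _ => _) = f \* cst (u i j)).
  by apply: derivableM => //; exact: derivable_cst.
by apply/funext => y; rewrite mxE.
Qed.

Lemma derivable_mkstate (h psi w : V -> R) (q p : V -> 'rV[R]_d) x v :
  derivable h x v -> derivable psi x v -> derivable q x v ->
  derivable w x v -> derivable p x v ->
  derivable (fun y => mkstate (h y) (psi y) (q y) (w y) (p y)) x v.
Proof.
move=> dh dpsi dq dw dp; rewrite /mkstate.
apply: derivable_row_mx; first exact: derivable_scalar1.
apply: derivable_row_mx; first exact: derivable_scalar1.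
apply: derivable_row_mx => //.
by apply: derivable_row_mx => //; exact: derivable_scalar1.
Qed.

Variable G : V -> 'rV[R]_(sdim d).
Variables (x v : V).
Hypothesis dG : derivable G x v.

Let dGk k : derivable (fun y => G y 0 k) x v.
Proof. exact: (derivable_mxP _ _ _).1. Qed.

Lemma derivable_s_h : derivable (fun y => s_h (G y)) x v.
Proof. by rewrite /s_h; under eq_fun do rewrite mxE; exact: dGk. Qed.

Lemma derive_s_h : s_h ('D_v G x) = 'D_v (fun y => s_h (G y)) x.
Proof.
rewrite /s_h derive_mx// !mxE; congr ('D_v _ x).
by apply/funext => y; rewrite mxE.
Qed.

Lemma derivable_s_psi : derivable (fun y => s_psi (G y)) x v.
Proof. by rewrite /s_psi; under eq_fun do rewrite !mxE; exact: dGk. Qed.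

Lemma derive_s_psi : s_psi ('D_v G x) = 'D_v (fun y => s_psi (G y)) x.
Proof.
rewrite /s_psi derive_mx// !mxE; congr ('D_v _ x).
by apply/funext => y; rewrite !mxE.
Qed.

Lemma derivable_s_w : derivable (fun y => s_w (G y)) x v.
Proof. by rewrite /s_w; under eq_fun do rewrite !mxE; exact: dGk. Qed.

Lemma derive_s_w : s_w ('D_v G x) = 'D_v (fun y => s_w (G y)) x.
Proof.
rewrite /s_w derive_mx// !mxE; congr ('D_v _ x).
by apply/funext => y; rewrite !mxE.
Qed.

Lemma derivable_s_q : derivable (fun y => s_q (G y)) x v.
Proof.
apply/derivable_mxP => i j; rewrite ord1 /s_q.
by under eq_fun do rewrite !mxE; exact: dGk.
Qed.

Lemma derive_s_q : s_q ('D_v G x) = 'D_v (fun y => s_q (G y)) x.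
Proof.
rewrite [RHS]derive_mx; last exact: derivable_s_q.
rewrite /s_q derive_mx//; apply/rowP => j; rewrite !mxE; congr ('D_v _ x).
by apply/funext => y; rewrite !mxE.
Qed.

Lemma derivable_s_p : derivable (fun y => s_p (G y)) x v.
Proof.
apply/derivable_mxP => i j; rewrite ord1 /s_p.
by under eq_fun do rewrite !mxE; exact: dGk.
Qed.

Lemma derive_s_p : s_p ('D_v G x) = 'D_v (fun y => s_p (G y)) x.
Proof.
rewrite [RHS]derive_mx; last exact: derivable_s_p.
rewrite /s_p derive_mx//; apply/rowP => j; rewrite !mxE; congr ('D_v _ x).
by apply/funext => y; rewrite !mxE.
Qed.

End derivable_state.

Variables (alpha beta gamma tau : R) (M Pi W : R -> R).

Definition flux (j : 'I_d) (u : 'rV[R]_(sdim d)) : 'rV[R]_(sdim d) :=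
  mkstate (s_q u 0 j)
          (alpha * s_q u 0 j)
          (((Pi (s_h u) + s_psi u) / tau) *: basis_vec j)
          (- (gamma / beta) * s_p u 0 j)
          (- s_w u *: basis_vec j).

Definition source (u : 'rV[R]_(sdim d)) : 'rV[R]_(sdim d) :=
  mkstate 0
          (- alpha * s_w u)
          (- (tau * M (s_h u))^-1 *: s_q u)
          (s_psi u / beta)
          0.

Definition hyperbolic_system (U : R -> 'rV[R]_d -> 'rV[R]_(sdim d))
    (t : R) (x : 'rV[R]_d) : Prop :=
  [/\ 'D_1 (fun s => s_h (U s x)) t + divergence (fun y => s_q (U t y)) x = 0,
      alpha^-1 * 'D_1 (fun s => s_psi (U s x)) t
        + divergence (fun y => s_q (U t y)) x = - s_w (U t x),
      tau *: 'D_1 (fun s => s_q (U s x)) t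
        + grad (fun y => Pi (s_h (U t y)) + s_psi (U t y)) x
        = - (M (s_h (U t x)))^-1 *: s_q (U t x),
      beta * 'D_1 (fun s => s_w (U s x)) t
        - gamma * divergence (fun y => s_p (U t y)) x = s_psi (U t x) &
      'D_1 (fun s => s_p (U s x)) t - grad (fun y => s_w (U t y)) x = 0].

Definition entropy (u : 'rV[R]_(sdim d)) : R :=
  W (s_h u) + s_psi u ^+ 2 / (2 * alpha) + tau * sqnorm (s_q u) / 2
  + beta * s_w u ^+ 2 / 2 + gamma * sqnorm (s_p u) / 2.

Definition entropy_flux (u : 'rV[R]_(sdim d)) : 'rV[R]_d :=
  (Pi (s_h u) + s_psi u) *: s_q u - (gamma * s_w u) *: s_p u.

End system.

Section equivalence.
Context {R : realType} {d : nat}.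

Lemma s_hD (u v : 'rV[R]_(sdim d)) : s_h (u + v) = s_h u + s_h v.
Proof. by rewrite /s_h linearD mxE. Qed.

Lemma s_psiD (u v : 'rV[R]_(sdim d)) : s_psi (u + v) = s_psi u + s_psi v.
Proof. by rewrite /s_psi !linearD mxE. Qed.

Lemma s_qD (u v : 'rV[R]_(sdim d)) : s_q (u + v) = s_q u + s_q v.
Proof. by rewrite /s_q !linearD. Qed.

Lemma s_wD (u v : 'rV[R]_(sdim d)) : s_w (u + v) = s_w u + s_w v.
Proof. by rewrite /s_w !linearD mxE. Qed.

Lemma s_pD (u v : 'rV[R]_(sdim d)) : s_p (u + v) = s_p u + s_p v.
Proof. by rewrite /s_p !linearD. Qed.

Lemma s_h_sum (I : finType) (f : I -> 'rV[R]_(sdim d)) :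
  s_h (\sum_i f i) = \sum_i s_h (f i).
Proof. by rewrite /s_h linear_sum summxE. Qed.

Lemma s_psi_sum (I : finType) (f : I -> 'rV[R]_(sdim d)) :
  s_psi (\sum_i f i) = \sum_i s_psi (f i).
Proof. by rewrite /s_psi !linear_sum summxE. Qed.

Lemma s_q_sum (I : finType) (f : I -> 'rV[R]_(sdim d)) :
  s_q (\sum_i f i) = \sum_i s_q (f i).
Proof. by rewrite /s_q !linear_sum. Qed.

Lemma s_w_sum (I : finType) (f : I -> 'rV[R]_(sdim d)) :
  s_w (\sum_i f i) = \sum_i s_w (f i).
Proof. by rewrite /s_w !linear_sum summxE. Qed.

Lemma s_p_sum (I : finType) (f : I -> 'rV[R]_(sdim d)) :
  s_p (\sum_i f i) = \sum_i s_p (f i).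
Proof. by rewrite /s_p !linear_sum. Qed.

Lemma derive_scale (V : normedModType R) (f : V -> R) n (u : 'rV[R]_n) x v :
  derivable f x v -> 'D_v (fun y => f y *: u) x = 'D_v f x *: u.
Proof.
move=> df; rewrite derive_mx; last exact: derivable_scale.
apply/rowP => j; rewrite !mxE.
rewrite (_ : (fun _ => _) = u 0 j \o* f); first by rewrite deriveMr// mulrC.
by apply/funext => y; rewrite !mxE.
Qed.

Lemma derivable_add (V : normedModType R) (f g : V -> R) x v :
  derivable f x v -> derivable g x v -> derivable (fun y => f y + g y) x v.
Proof.
by move=> df dg; rewrite (_ : (fun _ => _) = f + g); [exact: derivableD|].
Qed.

Lemma grad_row n (f : 'rV[R]_n -> R) x :
  grad f x = \sum_j 'D_(basis_vec j) f x *: basis_vec j.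
Proof. by rewrite [LHS]row_sum_delta; apply: eq_bigr => j _; rewrite mxE. Qed.

Lemma derivable_comp_dir (V : normedModType R) (g : R -> R) (f : V -> R) x v :
  derivable g (f x) 1 -> derivable f x v -> derivable (fun y => g (f y)) x v.
Proof.
move=> dg /derivable1P/derivable1_diffP df; apply/derivable1P.
apply/derivable1_diffP.
rewrite (_ : (fun _ => _) = g \o (fun h : R => f (h *: v + x)))//.
apply: differentiable_comp => //; apply/derivable1_diffP.
by rewrite scale0r add0r.
Qed.

Lemma derive_mkstate (V : normedModType R) (h psi w : V -> R)
    (q p : V -> 'rV[R]_d) x v :
  derivable h x v -> derivable psi x v -> derivable q x v ->
  derivable w x v -> derivable p x v ->
  'D_v (fun y => mkstate (h y) (psi y) (q y) (w y) (p y)) x =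
  mkstate ('D_v h x) ('D_v psi x) ('D_v q x) ('D_v w x) ('D_v p x).
Proof.
move=> dh dpsi dq dw dp.
have dG := derivable_mkstate dh dpsi dq dw dp.
apply/state_eqP; rewrite s_h_mk s_psi_mk s_q_mk s_w_mk s_p_mk.
rewrite (derive_s_h dG) (derive_s_psi dG) (derive_s_q dG) (derive_s_w dG).
rewrite (derive_s_p dG); split; congr ('D_v _ x); apply/funext => y.
- by rewrite s_h_mk.
- by rewrite s_psi_mk.
- by rewrite s_q_mk.
- by rewrite s_w_mk.
- by rewrite s_p_mk.
Qed.

Lemma derive_state (V : normedModType R) (G : V -> 'rV[R]_(sdim d)) x v :
  derivable G x v ->
  'D_v G x = mkstate ('D_v (fun y => s_h (G y)) x) ('D_v (fun y => s_psi (G y)) x)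
    ('D_v (fun y => s_q (G y)) x) ('D_v (fun y => s_w (G y)) x)
    ('D_v (fun y => s_p (G y)) x).
Proof.
move=> dG; apply/state_eqP; rewrite s_h_mk s_psi_mk s_q_mk s_w_mk s_p_mk.
rewrite (derive_s_h dG) (derive_s_psi dG) (derive_s_q dG) (derive_s_w dG).
by rewrite (derive_s_p dG).
Qed.

Lemma derive_sum_flux (r w : 'rV[R]_d -> R) (q p : 'rV[R]_d -> 'rV[R]_d)
    (a b c : R) x :
  (forall j, derivable r x (basis_vec j)) ->
  (forall j, derivable w x (basis_vec j)) ->
  (forall j, derivable q x (basis_vec j)) ->
  (forall j, derivable p x (basis_vec j)) ->
  \sum_j 'D_(basis_vec j) (fun y => mkstate (q y 0 j) (a * q y 0 j)
     ((r y / b) *: basis_vec j) (c * p y 0 j) (- w y *: basis_vec j)) x =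
  mkstate (divergence q x) (a * divergence q x) (b^-1 *: grad r x)
    (c * divergence p x) (- grad w x).
Proof.
move=> dr dw dq dp.
have dqk j : derivable (fun y => q y 0 j) x (basis_vec j).
  exact: (derivable_mxP q x (basis_vec j)).1 (dq j) 0 j.
have dpk j : derivable (fun y => p y 0 j) x (basis_vec j).
  exact: (derivable_mxP p x (basis_vec j)).1 (dp j) 0 j.
have dmul (k : R) f j : derivable f x (basis_vec j) ->
    derivable (fun y : 'rV[R]_d => k * f y) x (basis_vec j).
  move=> df; rewrite (_ : (fun _ => _) = cst k * f); last by [].
  exact: derivableM (derivable_cst _ _ _) df.
have Dmul (k : R) f j : derivable f x (basis_vec j) ->
    'D_(basis_vec j) (fun y : 'rV[R]_d => k * f y) x = k * 'D_(basis_vec j) f x.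
  by move=> df; rewrite -(deriveMl k df).
have rE : (fun y => r y / b) = (fun y => b^-1 * r y).
  by apply/funext => y; rewrite mulrC.
have wE : (fun y => - w y) = (fun y => -1 * w y).
  by apply/funext => y; rewrite mulN1r.
have drb j : derivable (fun y => r y / b) x (basis_vec j).
  by rewrite rE; exact: dmul (dr j).
have dwN j : derivable (fun y => - w y) x (basis_vec j).
  by rewrite wE; exact: dmul (dw j).
under eq_bigr => j _.
  rewrite (derive_mkstate (dqk j) (dmul a _ j (dqk j))
    (derivable_scale (u := basis_vec j) (drb j)) (dmul c _ j (dpk j))
    (derivable_scale (u := basis_vec j) (dwN j))).
  rewrite (Dmul a _ _ (dqk j)) (Dmul c _ _ (dpk j)).
  rewrite (derive_scale _ (drb j)).
  rewrite (derive_scale _ (dwN j)).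
  rewrite rE wE (Dmul _ _ _ (dr j)) (Dmul _ _ _ (dw j)).
  over.
apply/state_eqP; rewrite s_h_sum s_psi_sum s_q_sum s_w_sum s_p_sum.
rewrite s_h_mk s_psi_mk s_q_mk s_w_mk s_p_mk /divergence !grad_row.
rewrite !mulr_sumr scaler_sumr -sumrN.
split; apply: eq_bigr => j _.
- by rewrite s_h_mk.
- by rewrite s_psi_mk.
- by rewrite s_q_mk scalerA.
- by rewrite s_w_mk.
- by rewrite s_p_mk mulN1r scaleNr.
Qed.

Variables (alpha beta gamma tau : R) (M Pi : R -> R).

Lemma balance_law_hyperbolic_system (U : R -> 'rV[R]_d -> 'rV[R]_(sdim d))
    (t : R) (x : 'rV[R]_d) :
  0 < alpha -> 0 < beta -> 0 < tau ->
  derivable (U ^~ x) t 1 -> (forall j, derivable (U t) x (basis_vec j)) ->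
  derivable Pi (s_h (U t x)) 1 ->
  balance_law (flux alpha beta gamma tau Pi) (source alpha beta tau M) U t x <->
  hyperbolic_system alpha beta gamma tau M Pi U t x.
Proof.
move=> a0 b0 t0 dt dx dPi.
have dP j : derivable (fun y => Pi (s_h (U t y)) + s_psi (U t y)) x (basis_vec j).
  have dh := derivable_s_h (dx j).
  have dPh := derivable_comp_dir (g := Pi) (f := fun y => s_h (U t y)) dPi dh.
  have dpsi := derivable_s_psi (dx j).
  exact: (derivable_add dPh dpsi).
have := derive_sum_flux alpha tau (- (gamma / beta)) dP
  (fun j => derivable_s_w (dx j)) (fun j => derivable_s_q (dx j))
  (fun j => derivable_s_p (dx j)).
have := derive_state dt.
rewrite /balance_law /flux /source /hyperbolic_system => -> ->.
set h1 := 'D_1 (fun s => s_h _) t; set psi1 := 'D_1 (fun s => s_psi _) t.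
set q1 := 'D_1 (fun s => s_q _) t; set w1 := 'D_1 (fun s => s_w _) t.
set p1 := 'D_1 (fun s => s_p _) t; set dq := divergence (fun y => s_q _) x.
set dp := divergence (fun y => s_p _) x; set gw := grad (fun y => s_w _) x.
set gP := grad _ x; move: h1 psi1 q1 w1 p1 dq dp gw gP.
move=> h1 psi1 q1 w1 p1 dq dp gw gP.
rewrite state_eqP s_hD s_psiD s_qD s_wD s_pD.
rewrite !s_h_mk !s_psi_mk !s_q_mk !s_w_mk !s_p_mk.
set q := s_q _; set w := s_w _; set psi := s_psi _; set m := M _.
move: q w psi m => q w psi m {dt dx dPi dP}.
have an0 := lt0r_neq0 a0; have bn0 := lt0r_neq0 b0; have tn0 := lt0r_neq0 t0.
split=> -[e1 e2 e3 e4 e5]; split=> //.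
- apply: (mulfI an0); rewrite mulrDr mulrA divff// mul1r e2.
  by rewrite mulrN mulNr.
- have -> : gP = tau *: (tau^-1 *: gP) by rewrite scalerA divff// scale1r.
  by rewrite -scalerDr e3 scalerA mulrN invfM mulrA divff// mul1r.
- have -> : psi = beta * (psi / beta) by rewrite mulrCA divff// mulr1.
  by rewrite -e4; field.
- have -> : psi1 = alpha * (alpha^-1 * psi1) by rewrite mulrA divff// mul1r.
  by rewrite -mulrDr e2 mulrN mulNr.
- apply: (scalerI tn0); rewrite scalerDr !scalerA divff// scale1r e3.
  by rewrite mulrN invfM mulrA divff// mul1r.
- by rewrite -e4; field.
Qed.

End equivalence.

Section solution_equivalence.
Context {R : realType} {d : nat}.
Variables (alpha beta gamma tau : R) (M Pi : R -> R).

Lemma Ck_on_derivable_time (n : nat) (A : set (R * 'rV[R]_d))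
    (U : R -> 'rV[R]_d -> 'rV[R]_n) t x :
  Ck_on 1 A (fun z : R * 'rV[R]_d => U z.1 z.2) -> A (t, x) ->
  derivable (U ^~ x) t 1.
Proof.
move=> UC1 Atx; have [_ /(_ isT (t, x) (1, 0) Atx)] := UC1 [::] isT.
move=> /derivable1P dU; apply/derivable1P; move: dU.
rewrite (_ : (fun _ => _) = fun h : R => U (h *: 1 + t) x)//.
by apply/funext => h /=; rewrite scaler0 add0r.
Qed.

Lemma Ck_on_derivable_space (n : nat) (A : set (R * 'rV[R]_d))
    (U : R -> 'rV[R]_d -> 'rV[R]_n) t x v :
  Ck_on 1 A (fun z : R * 'rV[R]_d => U z.1 z.2) -> A (t, x) ->
  derivable (U t) x v.
Proof.
move=> UC1 Atx; have [_ /(_ isT (t, x) (0, v) Atx)] := UC1 [::] isT.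
move=> /derivable1P dU; apply/derivable1P; move: dU.
rewrite (_ : (fun _ => _) = fun h : R => U t (h *: v + x))//.
by apply/funext => h /=; rewrite scaler0 add0r.
Qed.

Lemma classical_solution_hyperbolic_system T
    (U : R -> 'rV[R]_d -> 'rV[R]_(sdim d)) :
  0 < alpha -> 0 < beta -> 0 < tau -> smooth Pi ->
  classical_solution state_space
    (balance_law (flux alpha beta gamma tau Pi) (source alpha beta tau M)) T U
  <->
  classical_solution state_space
    (hyperbolic_system alpha beta gamma tau M Pi) T U.
Proof.
move=> a0 b0 t0 sPi.
have dPi h : derivable Pi h 1.
  by have [_ /(_ isT h 1 Logic.I)] := sPi 1%N [::] isT.
have equiv t x : Ck_on 1 (slab `]0, T[) (fun z : R * 'rV[R]_d => U z.1 z.2) ->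
    0 < t < T ->
    balance_law (flux alpha beta gamma tau Pi) (source alpha beta tau M) U t x
    <-> hyperbolic_system alpha beta gamma tau M Pi U t x.
  move=> UC1 tT.
  have Atx : slab `]0, T[ (t, x) by rewrite /slab /= in_itv.
  apply: balance_law_hyperbolic_system => //.
    exact: Ck_on_derivable_time UC1 Atx.
  by move=> j; exact: Ck_on_derivable_space UC1 Atx.
by split=> -[per cont UC1 range eqn]; split=> // t x tT;
  apply/(equiv t x UC1 tT); exact: eqn.
Qed.

End solution_equivalence.

(* Main.v *)
(* The gradient of [E] is (Pi(h), psi/alpha, tau q, beta w, gamma p), so the
   Hessian is diagonal with entries Pi'(h), 1/alpha, tau, beta, gamma, and the
   compatibility condition is an identity between linear forms.  Since [Pi] is
   increasing on [0, oo[, the mean value theorem applied to [W] shows that the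
   graph of [E] lies strictly above its tangent planes, whence strict convexity.
   Along a classical solution, E(U)_t + div Q(U) = - |q|^2 / M(h) holds
   pointwise.  Multiplying by a weight phi, integrating over the torus (where
   divergences integrate to zero, by Fubini and the fundamental theorem of
   calculus) and then over time gives both the energy identity (phi = 1) and
   the weak entropy inequality (phi a test function).  As solutions are C^1 only
   in the open time interval, the integral over the torus is differentiated there
   and the end points are reached by continuity. *)
Require Import Defs.
From HB Require Import structures.
From mathcomp Require Import all_boot all_order all_algebra.
From mathcomp Require Import all_classical all_reals all_analysis.
From mathcomp Require Import measurable_realfun.
From mathcomp Require Import ring lra.

Set Implicit Arguments.
Unset Strict Implicit.
Unset Printing Implicit Defensive.
Import Order.TTheory GRing.Theory Num.Theory.
Import numFieldNormedType.Exports.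
Local Open Scope classical_set_scope.
Local Open Scope ring_scope.

(** The delicate point is the behaviour at the ends of the time interval. Derivatives of a solution
    may be unbounded near [t = 0] and [t = T], so the time derivative of the entropy and the
    divergence of its flux need not be separately integrable there. Their sum, however, is an
    expression in the values of [U] alone, and these are continuous on the closed slab. Hence the
    space integral of the entropy has a derivative that extends continuously to [[0, T]], and the
    fundamental theorem of calculus applies up to the end points without exhausting the interval
    from inside. A weight preserves this structure: the product rule only adds
    [E(U) phi_t + Q(U) . grad phi], again free of derivatives of [U]. Regularity is expressed by
    [Ck_on] through directional derivatives. The calculus below therefore works along lines and
    carries each derivative as an explicit formula; Jacobians enter only through the compatibility
    condition. *)

(** * Measurability and integrability of continuous functions on the unit cube *)

Section cube_integral.
Context {R : realType}.

(** Tuples carry the product sigma-algebra, row vectors the sup-norm topology. The bridge is that an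
    open set is the countable union of the balls with rational centre and radius that it contains,
    and a sup-norm ball is a box, that is, a finite intersection of preimages under coordinates. *)
Lemma open_row_measurable d (O : set 'rV[R]_d) :
  open O -> measurable [set x : d.-tuple R | O (\row_i tnth x i)].
Proof.
move=> oO.
pose box (p : d.-tuple rat * rat) : set 'rV[R]_d :=
  ball (\row_i ratr (tnth p.1 i) : 'rV[R]_d) (ratr p.2).
pose F p := [set x : d.-tuple R | box p `<=` O /\ box p (\row_i tnth x i)].
have -> : [set x : d.-tuple R | O (\row_i tnth x i)] = \bigcup_p F p.
  apply/seteqP; split=> x /=; last by move=> [p _ [pO]]; exact: pO.
  move=> Ox; have [e /= e0 eO] := (nbhs_ballP _ _).1 (open_nbhs_nbhs (conj oO Ox)).
  (* The centre is chosen within [r] of [x], so the ball of radius [r] around it stays within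
     [2 r < e] of [x]. *)
  have [r] := @rat_in_itvoo R 0 (e / 2) (divr_gt0 e0 (ltr0Sn _ 1)).
  rewrite in_itv/= => /andP[r0 re].
  have qP (i : 'I_d) : exists q : rat, `|ratr q - tnth x i| < ratr r.
    have [|q] := @rat_in_itvoo R (tnth x i - ratr r) (tnth x i + ratr r).
      by rewrite ltrBlDr -addrA ltrDl addr_gt0.
    by rewrite in_itv/= => /andP[? ?]; exists q; rewrite ltr_norml; apply/andP; lra.
  have [q qE] := choice qP.
  pose c := [tuple q i | i < d].
  exists (c, r) => //; split; last first.
    split=> // i j; rewrite !ord1 !mxE /= tnth_mktuple.
    exact: qE.
  move=> y [_ /= xy]; apply: eO; split=> // i j.
  have := xy i j; rewrite !ord1 !mxE /= tnth_mktuple /ball /= => H.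
  by have := qE j; have := H; rewrite !ltr_norml; lra.
apply: countable_bigcupT_measurable => [|p]; first exact: countableP.
have [pO|pO] := pselect (box p `<=` O); last first.
  by rewrite (_ : F p = set0)//; apply/seteqP; split=> x //= -[].
(* A ball of nonpositive radius is empty, which an intersection over the coordinates does not
   reflect when [d = 0]. *)
have [r0|r0] := ltP (0 : R) (ratr p.2); last first.
  rewrite (_ : F p = set0)//; apply/seteqP; split=> x //= -[_ [/=]].
  by move=> /lt_le_trans/(_ r0); rewrite ltxx.
rewrite (_ : F p = \big[setI/setT]_(i < d)
   (@tnth _ R ^~ i @^-1` ball (ratr (tnth p.1 i) : R) (ratr p.2))); last first.
  apply/seteqP; split=> x /=; rewrite -bigcap_seq/=.
    by move=> [_ [_ xp]] i _; have := xp 0 i; rewrite !mxE.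
  move=> xp; split=> //; split=> // i j; rewrite !mxE; apply: xp.
  by rewrite /= mem_index_enum.
apply: bigsetI_measurable => i _; rewrite -[X in measurable X]setTI.
apply: measurable_tnth => //.
by apply: open_measurable; exact: ball_open.
Qed.

Lemma continuous_row_measurable d (f : 'rV[R]_d -> R) :
  continuous f -> measurable_fun setT (fun x : d.-tuple R => f (\row_i tnth x i)).
Proof.
move=> /continuousP cf; apply: (measurability _ (RGenOpens.measurableE R)).
move=> _ [_ [a [b ->] <-]]; rewrite setTI.
apply: (@open_row_measurable d (f @^-1` `]a, b[%classic)).
exact/cf/interval_open.
Qed.

Lemma unit_cube_measurable d : measurable (@unit_cube R d).
Proof.
rewrite (_ : @unit_cube R d = \big[setI/setT]_(i < d) (@tnth _ R ^~ i @^-1` `[0, 1]%classic)).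
  apply: bigsetI_measurable => i _; rewrite -[X in measurable X]setTI.
  exact: measurable_tnth.
apply/seteqP; split=> x /=; rewrite -bigcap_seq/=; first by move=> xp i _; exact: xp.
by move=> xp i; apply: xp; rewrite /= mem_index_enum.
Qed.

Lemma unit_cube_measure d :
  tuple_measure (@lebesgue_measure R) d (@unit_cube R d) = 1%E.
Proof.
have -> : @unit_cube R d = [set x | forall i : 'I_d, `[0%R, 1%R]%classic (tnth x i)] by [].
rewrite (@tuple_measure_box _ _ R (@lebesgue_measure R) d (fun=> `[0%R, 1%R]%classic))//.
rewrite big1// => i _.
transitivity (@lebesgue_measure R `[0%R, 1%R]%classic) => //.
by rewrite lebesgue_measure_itv/= lte_fin ltr01 oppr0 adde0.
Qed.

Definition cube_rows (d : nat) : set 'rV[R]_d := [set v | forall i, `[0, 1]%classic (v 0 i)].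

Lemma cube_rows_compact d : compact (@cube_rows d).
Proof. by apply: (@rV_compact R d (fun=> `[0, 1]%classic)) => i; exact: segment_compact. Qed.

Lemma unit_cube_row d (x : d.-tuple R) : @unit_cube R d x <-> @cube_rows d (\row_i tnth x i).
Proof. by split=> xu i; have := xu i; rewrite /= ?mxE. Qed.

(** The bound comes from compactness of the time interval times the cube. Being uniform in time, it
    provides the constant dominating function for limits and derivatives under the integral sign. *)
Lemma continuous_cube_bounded d (f : R -> 'rV[R]_d -> R) a b :
  {within `[a, b]%classic `*` @cube_rows d,
    continuous (fun z : R * 'rV[R]_d => f z.1 z.2)} ->
  exists C, forall t x, t \in `[a, b] -> @unit_cube R d x ->
    `|f t (\row_i tnth x i)| <= C.
Proof.
move=> cf.
have K : compact (`[a, b]%classic `*` @cube_rows d).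
  by apply: compact_setX; [exact: segment_compact|exact: cube_rows_compact].
have := continuous_compact cf K.
move=> /compact_bounded [C [_ /(_ (C + 1))]]; rewrite ltrDl ltr01 => /(_ isT) fC.
exists (C + 1) => t x tab xu; apply: fC; exists (t, \row_i tnth x i) => //.
by split=> //; exact/unit_cube_row.
Qed.

Lemma cube_integrable d (f : 'rV[R]_d -> R) : continuous f ->
  (tuple_measure (@lebesgue_measure R) d).-integrable (@unit_cube R d)
    (EFin \o (fun x => f (\row_i tnth x i))).
Proof.
move=> cf; apply: measurable_bounded_integrable.
- exact: unit_cube_measurable.
- by rewrite [ltLHS]unit_cube_measure ltry.
- by apply: measurable_funTS; exact: continuous_row_measurable.
have [|C fC] := @continuous_cube_bounded d (fun=> f) 0 1.
  apply: continuous_subspaceT => z.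
  by apply: continuous_comp; [exact: cvg_snd|exact: cf].
exists C; split; first exact: num_real.
move=> M CM x /= xu; apply: le_trans (ltW CM); apply: (fC 0) => //.
by rewrite in_itv/= lexx ler01.
Qed.

End cube_integral.

(** * Fubini on the cube, and vanishing integrals of derivatives of periodic functions *)

Section cube_fubini.
Context {R : realType}.

Lemma continuous_row (T : topologicalType) n (g : T -> 'rV[R]_n) x :
  (forall j, {for x, continuous (fun y => g y 0 j)}) -> {for x, continuous g}.
Proof.
move=> gc; apply/cvg_ballP => e e0.
have : \forall y \near x, forall j, ball (g x 0 j) e (g y 0 j).
  by apply: filter_forall => j; have /cvg_ballP/(_ e e0) := gc j.
by apply: filterS => y gxy; split=> // i j; rewrite ord1.
Qed.


Definition cons_row n (a : R) (x : 'rV[R]_n) : 'rV[R]_n.+1 :=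
  \row_i oapp (x 0) a (unlift ord0 i).

(** Since [c] sends the line through [u] along [w] to the line through [c u] along [v], both
    difference quotients are the same function of [h]. This covers slices in time, in space and in
    the coordinates of the cube. *)
Lemma is_derive_line (U V W : normedModType R) (f : V -> W) (c : U -> V) u w v df :
  (forall h, c (h *: w + u) = h *: v + c u) ->
  is_derive (c u) v f df -> is_derive u w (fun y => f (c y)) df.
Proof.
move=> cE [d1 d2].
have E : (fun h => h^-1 *: (((fun y => f (c y)) \o shift u) (h *: w) - f (c u))) =
    (fun h => h^-1 *: ((f \o shift (c u)) (h *: v) - f (c u))).
  by apply/funext => h /=; rewrite cE.
by split; [rewrite /derivable E|rewrite /derive E].
Qed.

Lemma cons_row_tcons n (z : R * n.-tuple R) :
  \row_i tnth (tcons z) i = cons_row z.1 (\row_i tnth z.2 i).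
Proof.
apply/rowP => i; rewrite !mxE; case: (unliftP ord0 i) => [j ->|->] /=.
  by rewrite mxE tnthS.
by [].
Qed.

Lemma cons_rowDl n (a b : R) (x : 'rV[R]_n) :
  cons_row (a + b) x = b *: basis_vec ord0 + cons_row a x.
Proof.
apply/rowP => i; rewrite !mxE eqxx /=; case: (unliftP ord0 i) => [j ->|->] /=.
  by rewrite mulr0 add0r.
by rewrite mulr1 addrC.
Qed.

Lemma cons_rowDr n (a b : R) (x : 'rV[R]_n) j :
  cons_row a (b *: basis_vec j + x) = b *: basis_vec (lift ord0 j) + cons_row a x.
Proof.
apply/rowP => i; rewrite !mxE eqxx /=; case: (unliftP ord0 i) => [k ->|->] /=.
  by rewrite !mxE eqxx/= (inj_eq lift_inj).
by rewrite mulr0 add0r.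
Qed.

Lemma tcons_unit_cube n :
  @tcons _ R n @^-1` @unit_cube R n.+1 = `[0, 1]%classic `*` @unit_cube R n.
Proof.
apply/seteqP; split=> [[a x] /= ax|].
  by split=> [|i]; [exact: (ax ord0)|rewrite -(tnthS a x); exact: ax].
move=> [a x] /= [a01 xu] i; case: (unliftP ord0 i) => [j ->|->] //.
by rewrite tnthS.
Qed.


Lemma cons_row_continuous n : continuous (fun z : R * 'rV[R]_n => cons_row z.1 z.2).
Proof.
move=> z; apply: continuous_row => j.
have -> : (fun y : R * 'rV[R]_n => cons_row y.1 y.2 0 j) =
    fun y => oapp (y.2 0) y.1 (unlift ord0 j).
  by apply/funext => y; rewrite mxE.
case: (unliftP ord0 j) => [k _|_] /=; last exact: cvg_fst.
apply: (@continuous_comp _ _ _ snd (fun v : 'rV[R]_n => v 0 k)); first exact: cvg_snd.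
exact: coord_continuous.
Qed.

Let mu : {sigma_finite_measure set (measurableTypeR R) -> \bar R} := @lebesgue_measure R.

Section fubini.
Variables (n : nat) (f : 'rV[R]_n.+1 -> R).
Hypothesis cf : continuous f.
Let D : set (measurableTypeR R * n.-tuple (measurableTypeR R)) :=
  `[0, 1]%classic `*` @unit_cube R n.
Let g (z : measurableTypeR R * n.-tuple (measurableTypeR R)) :=
  (f (cons_row z.1 (\row_i tnth z.2 i)))%:E.

Let mD : measurable D.
Proof. by apply: measurableX => //; exact: unit_cube_measurable. Qed.

Let g_integrable : (mu \x tuple_measure mu n)%E.-integrable D g.
Proof.
have gE : g = (EFin \o fun x : n.+1.-tuple R => f (\row_i tnth x i)) \o (@tcons _ R n).
  by apply/funext => z /=; rewrite /g cons_row_tcons.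
apply: measurable_bounded_integrable => //.
- have -> : D = @tcons _ R n @^-1` @unit_cube R n.+1 by rewrite tcons_unit_cube.
  have := @unit_cube_measure R n.+1; rewrite /= /tuple_measureS /pushforward => ->.
  by rewrite ltry.
- apply: measurable_funTS.
  have -> : (fun z : R * n.-tuple R => f (cons_row z.1 (\row_i tnth z.2 i))) =
      (fun x : n.+1.-tuple R => f (\row_i tnth x i)) \o (@tcons _ R n).
    by apply/funext => z /=; rewrite cons_row_tcons.
  apply: measurableT_comp; last exact: measurable_tcons.
  exact: continuous_row_measurable.
have [|C fC] := @continuous_cube_bounded R n (fun a x => f (cons_row a x)) 0 1.
  apply: continuous_subspaceT => z.
  apply: (@continuous_comp _ _ _ (fun z : R * 'rV[R]_n => cons_row z.1 z.2) f).
    exact: cons_row_continuous.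
  exact: cf.
exists C; split; first exact: num_real.
by move=> M CM x /= [x1 x2]; apply: le_trans (ltW CM); exact: fC.
Qed.

(** The measure on [n.+1]-tuples is the image of a product measure under [tcons], so this is a
    change of variables. *)
Let torusE : torus_integral f = fine (\int[mu \x tuple_measure mu n]_(z in D) g z)%E.
Proof.
congr fine; rewrite /= /tuple_measureS integral_pushforward.
- by rewrite tcons_unit_cube; apply: eq_integral => z _ /=; rewrite /g cons_row_tcons.
- exact: measurable_tcons.
- by apply/measurable_EFinP; exact: continuous_row_measurable.
- rewrite tcons_unit_cube.
  have -> : (fun x : n.+1.-tuple R => (f (\row_i tnth x i))%:E) \o (@tcons _ R n) = g.
    by apply/funext => z /=; rewrite /g cons_row_tcons.
  exact: g_integrable.
- exact: unit_cube_measurable.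
Qed.

(** Fubini is applied on the whole product space, hence the extension of [g] by zero outside [D]. *)
Let gD_integrable : (mu \x tuple_measure mu n)%E.-integrable setT (g \_ D).
Proof. exact: (integrable_mkcond g mD).1 g_integrable. Qed.

Let torus_mkcondE :
  torus_integral f = fine (\int[mu \x tuple_measure mu n]_z (g \_ D) z)%E.
Proof. by rewrite torusE integral_mkcond. Qed.


Lemma cons_row_continuousl (a : R) : continuous (fun x : 'rV[R]_n => f (cons_row a x)).
Proof.
move=> x; apply: (@continuous_comp _ _ _ (fun x : 'rV[R]_n => cons_row a x) f); last exact: cf.
apply: (@continuous_comp _ _ _ (fun x : 'rV[R]_n => (a, x))
  (fun z : R * 'rV[R]_n => cons_row z.1 z.2)); last exact: cons_row_continuous.
apply: (@cvg_pair _ _ _ (nbhs x) (nbhs a) (nbhs x) _ _ _ (fun=> a) id).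
  exact: (@cvg_cst R).
exact: cvg_id.
Qed.

Lemma cons_row_continuousr (x : 'rV[R]_n) : continuous (fun a => f (cons_row a x)).
Proof.
move=> a; apply: (@continuous_comp _ _ _ (fun a => cons_row a x) f); last exact: cf.
apply: (@continuous_comp _ _ _ (fun a => (a, x))
  (fun z : R * 'rV[R]_n => cons_row z.1 z.2)); last exact: cons_row_continuous.
exact: cvg_pair cvg_id (cvg_cst _).
Qed.

Lemma torus_integral_fubinil :
  torus_integral f = \int[mu]_(a in `[0, 1]) torus_integral (fun x => f (cons_row a x)).
Proof.
rewrite torus_mkcondE -(integral12_prod_meas1 gD_integrable); congr fine.
rewrite [RHS]integral_mkcond; apply: eq_integral => a _; rewrite /fubini_F.
rewrite patchE; case: ifPn => a01.
  rewrite /torus_integral /Rintegral fineK; last first.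
    apply: integrable_fin_num; first exact: unit_cube_measurable.
    exact: (cube_integrable (cons_row_continuousl (a := a))).
  rewrite [RHS]integral_mkcond; apply: eq_integral => x _.
  by rewrite !patchE in_setX/= a01.
apply: integral0_eq => x _; rewrite patchE ifN//.
by apply: contra a01; rewrite !inE => -[].
Qed.

Lemma torus_integral_fubinir :
  torus_integral f = torus_integral (fun x => \int[mu]_(a in `[0, 1]) f (cons_row a x)).
Proof.
rewrite torus_mkcondE -(integral21_prod_meas1 gD_integrable); congr fine.
rewrite [RHS]integral_mkcond; apply: eq_integral => x _; rewrite /fubini_G.
rewrite patchE; case: ifPn => xu.
  rewrite /Rintegral fineK; last first.
    apply: integrable_fin_num => //.
    apply: continuous_compact_integrable; first exact: segment_compact.
    by apply: continuous_subspaceT; exact: cons_row_continuousr.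
  rewrite [RHS]integral_mkcond; apply: eq_integral => a _.
  by rewrite !patchE in_setX/= xu andbT.
apply: integral0_eq => a _; rewrite patchE ifN//.
by apply: contra xu; rewrite !inE => -[].
Qed.

End fubini.

(** Induction on the dimension, splitting off the first coordinate. If [j] is another coordinate,
    the first one is integrated last and the inner integral vanishes by induction. If [j] is the
    first one, it is integrated first: the inner integral is the difference of the values of [g] at
    opposite faces, which is zero by periodicity. *)
Lemma torus_integral_derive n (g g' : 'rV[R]_n -> R) (j : 'I_n) :
  continuous g' -> (forall x, is_derive x (basis_vec j) g (g' x)) ->
  (forall x, g (x + basis_vec j) = g x) -> torus_integral g' = 0.
Proof.
elim: n g g' j => [|n IH] g g' j cg' dg gper; first by case: j dg gper.
case: (unliftP ord0 j) => [k jE|jE].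
  rewrite torus_integral_fubinil//.
  under eq_Rintegral => a _.
    have -> : torus_integral (fun x => g' (cons_row a x)) = 0.
      apply: (IH (fun x => g (cons_row a x)) _ k).
      - exact: cons_row_continuousl.
      - move=> x; apply: (is_derive_line _ (dg _)) => h.
        by rewrite jE cons_rowDr.
      - move=> x; rewrite addrC -[X in X + x]scale1r cons_rowDr scale1r addrC -jE.
        exact: gper.
    over.
  by rewrite /Rintegral integral0.
rewrite torus_integral_fubinir//.
rewrite (_ : (fun x => _) = cst 0); last first.
  apply/funext => x.
  have dx (a : R) : is_derive a 1 (fun a => g (cons_row a x)) (g' (cons_row a x)).
    apply: (is_derive_line _ (dg _)) => h.
    by rewrite jE scaler1 addrC cons_rowDl.
  have cx (a : R) : {for a, continuous (fun a => g (cons_row a x))}.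
    apply: differentiable_continuous; apply/derivable1_diffP; exact: ex_derive.
  rewrite /Rintegral (@continuous_FTC2 _ _ (fun a => g (cons_row a x))) ?ltr01//; first last.
  - by move=> a _; rewrite derive1E derive_val.
  - split; first by move=> a _; exact: ex_derive.
    + by apply: cvg_at_right_filter; exact: cx.
    + by apply: cvg_at_left_filter; exact: cx.
  - by apply: continuous_subspaceT; exact: cons_row_continuousr.
  rewrite -EFinB/= -[in cons_row 1 x](add0r 1) cons_rowDl scale1r.
  by rewrite [basis_vec _ + _]addrC -jE gper subrr.
by rewrite /torus_integral /Rintegral integral0.
Qed.

End cube_fubini.

(** * Integration of a balance law over the torus and over time *)

Section balance.
Context {R : realType}.

Lemma within_continuous_comp (X Y Z : topologicalType) (A : set Y) (f : Y -> Z) (g : X -> Y) :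
  {within A, continuous f} -> continuous g -> (forall x, A (g x)) -> continuous (f \o g).
Proof.
move=> /subspace_continuousP cf cg Ag x P fgP.
have gP : \forall y \near x, A (g y) -> P (f (g y)) := cg x _ (cf _ (Ag x) P fgP).
by apply: filterS gP => y; apply; exact: Ag.
Qed.

Lemma torus_integral_sum d (I : finType) (g : I -> 'rV[R]_d -> R) :
  (forall i, continuous (g i)) ->
  torus_integral (fun x => \sum_i g i x) = \sum_i torus_integral (g i).
Proof.
move=> cg; rewrite /torus_integral /Rintegral.
under eq_integral do rewrite -sumEFin.
rewrite (@integral_sum _ _ R) //; last first.
  by move=> i; exact: cube_integrable.
  exact: unit_cube_measurable.
rewrite -[RHS]/(fine (\sum_i torus_integral (g i))%:E) -sumEFin; congr fine.
apply: eq_bigr => i _; rewrite fineK//; apply: integrable_fin_num.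
  exact: unit_cube_measurable.
exact: cube_integrable.
Qed.

Lemma torus_integralB d (f g : 'rV[R]_d -> R) : continuous f -> continuous g ->
  torus_integral (fun x => f x - g x) = torus_integral f - torus_integral g.
Proof.
move=> cf cg; rewrite /torus_integral RintegralB//; first exact: unit_cube_measurable.
  exact: cube_integrable.
exact: cube_integrable.
Qed.

Section time_dependent.
Variables (d : nat) (f : R -> 'rV[R]_d -> R).

Lemma continuous_slicel (t : R) :
  (forall x, {for (t, x), continuous (fun z : R * 'rV[R]_d => f z.1 z.2)}) ->
  continuous (f t).
Proof.
move=> cf x; apply: (@continuous_comp _ _ _ (fun y : 'rV[R]_d => (t, y))
  (fun z : R * 'rV[R]_d => f z.1 z.2)); last exact: cf.
apply: (@cvg_pair _ _ _ (nbhs x) (nbhs t) (nbhs x) _ _ _ (fun=> t) id).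
  exact: (@cvg_cst R).
exact: cvg_id.
Qed.

Lemma continuous_slicer (x : 'rV[R]_d) (t : R) :
  {for (t, x), continuous (fun z : R * 'rV[R]_d => f z.1 z.2)} ->
  {for t, continuous (f ^~ x)}.
Proof.
move=> cf; apply: (@continuous_comp _ _ _ (fun s : R => (s, x))
  (fun z : R * 'rV[R]_d => f z.1 z.2)); last exact: cf.
exact: (cvg_pair (@cvg_id _ _) (cvg_cst x)).
Qed.

Hypothesis cf : continuous (fun z : R * 'rV[R]_d => f z.1 z.2).

Lemma torus_integral_continuous : continuous (fun t => torus_integral (f t)).
Proof.
(* Continuity at [t] is local, so domination on a compact window around [t] is enough. *)
move=> t; have [C fC] := @continuous_cube_bounded R d f (t - 1) (t + 1) (continuous_subspaceT cf).
apply: (@continuity_under_integral R _ _ (tuple_measure (@lebesgue_measure R) d)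
  (fun t (x : d.-tuple R) => f t (\row_i tnth x i)) (@unit_cube R d) _ (t - 1) (t + 1) _ _ (cst C)).
- exact: unit_cube_measurable.
- by move=> s _; apply: cube_integrable; apply: continuous_slicel => x; exact: cf.
- by apply: aeW => x _ s _; apply: continuous_slicer; exact: cf.
- by apply: cube_integrable; exact: cst_continuous.
- move=> s sI; apply: aeW => x xu; apply: fC => //.
  exact: subset_itv_oo_cc.
- by rewrite inE/= in_itv/=; apply/andP; split; lra.
Qed.

Lemma torus_integral_is_derive (f' : R -> 'rV[R]_d -> R) (a b t : R) : a < t < b ->
  (forall s x, a < s < b -> is_derive s 1 (f ^~ x) (f' s x)) ->
  (forall s x, a < s < b -> {for (s, x), continuous (fun z : R * 'rV[R]_d => f' z.1 z.2)}) ->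
  is_derive t 1 (fun s => torus_integral (f s)) (torus_integral (f' t)).
Proof.
move=> /andP[at_ tb] df cf'.
(* Nothing is known about [f'] near [a] and [b]; the midpoints cut out a compact interval around [t]
   on which it is bounded. *)
pose u := (a + t) / 2; pose v := (t + b) / 2.
have inab s : s \in `[u, v] -> a < s < b.
  by rewrite in_itv/= /u /v => /andP[? ?]; apply/andP; split; lra.
have [C fC] : exists C, forall s x, s \in `[u, v] -> @unit_cube R d x ->
    `|f' s (\row_i tnth x i)| <= C.
  apply: continuous_cube_bounded; apply: continuous_in_subspaceT => -[s x].
  by rewrite inE => -[/= /inab sab _]; exact: cf'.
have dE s x : s \in `]u, v[ -> partial1of2 (fun t (x : d.-tuple R) => f t (\row_i tnth x i)) s x
    = f' s (\row_i tnth x i).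
  move=> /subset_itv_oo_cc/inab sab; rewrite partial1of2E.
  by have [_ ->] := df s (\row_i tnth x i) sab.
pose fin := (fun t (x : d.-tuple R) => f t (\row_i tnth x i)).
have tI : `]u, v[%classic t by rewrite /= in_itv/= /u /v; apply/andP; split; lra.
have intf s : `]u, v[%classic s -> (tuple_measure (@lebesgue_measure R) d).-integrable
    (@unit_cube R d) (EFin \o fin s).
  by move=> _; apply: cube_integrable; apply: continuous_slicel => x; exact: cf.
have derf s x : `]u, v[%classic s -> @unit_cube R d x -> derivable (fin ^~ x) s 1.
  by move=> /subset_itv_oo_cc/inab sab _; have [] := df s (\row_i tnth x i) sab.
have C0 (x : d.-tuple R) : 0 <= `|C| by [].
have intC : (tuple_measure (@lebesgue_measure R) d).-integrable
    (@unit_cube R d) (EFin \o (fun=> `|C|)).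
  by apply: (@cube_integrable _ _ (fun=> `|C|)); exact: cst_continuous.
have ubC s x : `]u, v[%classic s -> @unit_cube R d x -> `|partial1of2 fin s x| <= `|C|.
  move=> suv xu; rewrite dE//; apply: le_trans (ler_norm C); apply: fC => //.
  exact: subset_itv_oo_cc.
split.
  exact: (@derivable_under_integral R _ _ (tuple_measure (@lebesgue_measure R) d)
    fin (@unit_cube R d) (@unit_cube_measurable R d) t u v tI intf derf _ C0 intC ubC).
rewrite -derive1E.
have := @differentiation_under_integral R _ _ (tuple_measure (@lebesgue_measure R) d)
  fin (@unit_cube R d) (@unit_cube_measurable R d) t u v tI intf derf _ C0 intC ubC.
rewrite /torus_integral => ->; apply: eq_Rintegral => x _.
by rewrite dE.
Qed.

End time_dependent.

(* Precomposing with this retraction onto [0, T] turns continuity within the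
   slab into continuity on the whole of R * R^d. *)
Definition clamp (T t : R) : R := (`|t| - `|t - T| + T) / 2.

Lemma clamp_itv T t : 0 <= T -> 0 <= clamp T t <= T.
Proof.
move=> T0; rewrite /clamp; case: (ler0P t) => ?; case: (ler0P (t - T)) => ?; apply/andP; split; lra.
Qed.

Lemma clamp_id T t : 0 <= t <= T -> clamp T t = t.
Proof.
move=> /andP[t0 tT]; rewrite /clamp ger0_norm// ler0_norm; lra.
Qed.

Lemma clamp_continuous T : continuous (clamp T).
Proof.
move=> t; apply: cvgMl; apply: cvgD; last exact: cvg_cst.
apply: cvgB; first exact: norm_continuous.
apply: cvg_norm; apply: cvgB; [exact: cvg_id|exact: cvg_cst].
Qed.

Lemma clamp_slab_continuous d T (g : R * 'rV[R]_d -> R) : 0 <= T ->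
  {within slab `[0, T], continuous g} ->
  continuous (fun z : R * 'rV[R]_d => g (clamp T z.1, z.2)).
Proof.
move=> T0 cg; apply: (within_continuous_comp (g := fun z : R * 'rV[R]_d => (clamp T z.1, z.2)) cg).
  move=> z; apply: (@cvg_pair _ _ _ (nbhs z) (nbhs (clamp T z.1)) (nbhs z.2)).
    apply: (@continuous_comp _ _ _ fst (clamp T)); first exact: cvg_fst.
    exact: clamp_continuous.
  exact: cvg_snd.
by move=> z; rewrite /slab /= in_itv/=; exact: clamp_itv.
Qed.

Lemma time_line d (h s : R) (x : 'rV[R]_d) :
  (h *: 1 + s, x) = h *: (1, 0) + (s, x) :> R * 'rV[R]_d.
Proof. by rewrite -[RHS]/(h *: 1 + s, h *: 0 + x) scaler0 add0r. Qed.

Lemma space_line d (h s : R) (v x : 'rV[R]_d) :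
  (s, h *: v + x) = h *: (0, v) + (s, x) :> R * 'rV[R]_d.
Proof. by rewrite -[RHS]/(h * 0 + s, h *: v + x) mulr0 add0r. Qed.

Let eta2 d (g : R * 'rV[R]_d -> R) : (fun z => g (z.1, z.2)) = g.
Proof. by apply/funext => -[]. Qed.

(** Integration over the torus removes the [V'], so the derivative of the integral of [f] is the
    integral of [r]. While [f'] and [V'] are controlled only for [0 < t < T], [r] is continuous on
    the closed slab, and so is its space integral up to [0] and [T]. *)
Lemma balance_integral d (T : R) (f f' r : R * 'rV[R]_d -> R)
    (V V' : 'I_d -> R * 'rV[R]_d -> R) :
  {within slab `[0, T], continuous f} -> {within slab `[0, T], continuous r} ->
  (forall t x, 0 < t < T -> is_derive (t, x) (1, 0) f (f' (t, x))) ->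
  (forall t x, 0 < t < T -> {for (t, x), continuous f'}) ->
  (forall j t x, 0 < t < T -> is_derive (t, x) (0, basis_vec j) (V j) (V' j (t, x))) ->
  (forall j t x, 0 < t < T -> {for (t, x), continuous (V' j)}) ->
  (forall j t x, 0 < t < T -> V j (t, x + basis_vec j) = V j (t, x)) ->
  (forall t x, 0 < t < T -> f' (t, x) + \sum_j V' j (t, x) = r (t, x)) ->
  forall t, 0 < t <= T ->
  time_integral 0 t (fun s => torus_integral (fun x => r (s, x))) =
  torus_integral (fun x => f (t, x)) - torus_integral (fun x => f (0, x)).
Proof.
move=> cf cr df cf' dV cV' perV eqn t /andP[t0 tT].
have T0 : 0 <= T by exact: ltW (lt_le_trans t0 tT).
pose F s := torus_integral (fun x => f (clamp T s, x)).
pose G s := torus_integral (fun x => r (clamp T s, x)).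
have cF : continuous F.
  by apply: torus_integral_continuous; exact: clamp_slab_continuous.
have cG : continuous G.
  by apply: torus_integral_continuous; exact: clamp_slab_continuous.
have cl s : 0 < s < T -> clamp T s = s.
  by move=> /andP[/ltW ? /ltW ?]; rewrite clamp_id//; apply/andP.
have dF s : 0 < s < T -> is_derive s 1 F (G s).
  (* Here [f'] is [r] minus the sum of the [V'], each of which is a derivative of a periodic
     function and integrates to zero. *)
  move=> sT; have -> : G s = torus_integral (fun x => f' (s, x)).
    have -> : G s = torus_integral (fun x => r (s, x)) by rewrite /G cl.
    have cVs j : continuous (fun x => V' j (s, x)).
      by apply: (continuous_slicel (f := fun s x => V' j (s, x))) => x; rewrite eta2; exact: cV'.
    have cfs : continuous (fun x => f' (s, x)).
      by apply: (continuous_slicel (f := fun s x => f' (s, x))) => x; rewrite eta2; exact: cf'.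
    have -> : (fun x => f' (s, x)) = (fun x => r (s, x) - \sum_j V' j (s, x)).
      by apply/funext => x; rewrite -eqn// addrK.
    rewrite torus_integralB.
    - rewrite torus_integral_sum// big1 ?subr0// => j _.
      apply: (@torus_integral_derive R d (fun x => V j (s, x)) _ j) => //.
      + move=> x; apply: (is_derive_line _ (dV j s x sT)) => h /=.
        exact: space_line.
      + by move=> x; exact: perV.
    - have -> : (fun x => r (s, x)) = (fun x => r (clamp T s, x)) by rewrite cl.
      apply: (continuous_slicel (f := fun s x => r (clamp T s, x))) => x.
      exact: clamp_slab_continuous.
    - apply: continuous_big => [|j _]; last exact: cVs.
      exact: add_continuous.
  apply: (@torus_integral_is_derive d (fun s x => f (clamp T s, x)) _
    (fun s x => f' (s, x)) 0 T s) => //.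
  - exact: clamp_slab_continuous.
  - move=> {}s x {}sT.
    have dfs : is_derive s 1 (fun s => f (s, x)) (f' (s, x)).
      by apply: (is_derive_line _ (df s x sT)) => h /=; exact: time_line.
    apply: near_eq_is_derive dfs.
    have /near_in_itvoo : s \in `]0, T[ by rewrite in_itv.
    by apply: filterS => z; rewrite in_itv/= => zT; rewrite cl.
  - by move=> {}s x {}sT; rewrite eta2; exact: cf'.
have inT s : s \in `]0, t[ -> 0 < s < T.
  by rewrite in_itv/= => /andP[-> /lt_le_trans->].
transitivity (time_integral 0 t G).
  apply: eq_Rintegral => s; rewrite inE/= in_itv/= => /andP[s0 st].
  by rewrite /G clamp_id// s0 (le_trans st tT).
rewrite /time_integral /Rintegral (@continuous_FTC2 _ _ F) //.
- by rewrite -EFinB/= /F !clamp_id ?lexx ?T0 ?tT ?(ltW t0).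
- exact: continuous_subspaceT.
- split.
  + by move=> s /inT sT; have [] := dF s sT.
  + by apply: cvg_at_right_filter; exact: cF.
  + by apply: cvg_at_left_filter; exact: cF.
- by move=> s /inT sT; rewrite derive1E; have [_ ->] := dF s sT.
Qed.

Section space_time_integral.
Variables (d : nat) (T t : R).
Hypothesis tT : 0 <= t <= T.

Let T_ge0 : 0 <= T.
Proof. by case/andP: tT; exact: le_trans. Qed.

Lemma slab_slice_continuous (g : R * 'rV[R]_d -> R) s : 0 <= s <= T ->
  {within slab `[0, T], continuous g} -> continuous (fun x => g (s, x)).
Proof.
move=> sT cg; rewrite -(clamp_id sT).
apply: (continuous_slicel (f := fun s x => g (clamp T s, x))) => x.
exact: clamp_slab_continuous.
Qed.

Lemma space_time_integrable (g : R * 'rV[R]_d -> R) :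
  {within slab `[0, T], continuous g} ->
  (@lebesgue_measure R).-integrable `[0, t]
    (EFin \o (fun s => torus_integral (fun x => g (s, x)))).
Proof.
move=> cg; pose G s := torus_integral (fun x => g (clamp T s, x)).
have : (@lebesgue_measure R).-integrable `[0, t] (EFin \o G).
  apply: continuous_compact_integrable; first exact: segment_compact.
  apply: continuous_subspaceT.
  by apply: torus_integral_continuous; exact: clamp_slab_continuous.
apply: eq_integrable => // s; rewrite inE/= in_itv/= => /andP[s0 st].
by rewrite /G clamp_id// s0 (le_trans st)//; case/andP: tT.
Qed.

Lemma space_time_integralB (g h : R * 'rV[R]_d -> R) :
  {within slab `[0, T], continuous g} -> {within slab `[0, T], continuous h} ->
  time_integral 0 t (fun s => torus_integral (fun x => g (s, x) - h (s, x))) =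
  time_integral 0 t (fun s => torus_integral (fun x => g (s, x))) -
  time_integral 0 t (fun s => torus_integral (fun x => h (s, x))).
Proof.
move=> cg ch; rewrite /time_integral -RintegralB//; first last.
- exact: space_time_integrable.
- exact: space_time_integrable.
apply: eq_Rintegral => s; rewrite inE/= in_itv/= => /andP[s0 st].
have sT : 0 <= s <= T by rewrite s0 (le_trans st)//; case/andP: tT.
by rewrite torus_integralB//; exact: slab_slice_continuous.
Qed.

End space_time_integral.

End balance.

(** * Calculus of continuously differentiable functions along directions *)

Section C1_calculus.
Context {R : realType} {V : normedModType R}.
Implicit Types A : set V.

(** The derivative is a formula [f' v x] in the direction and the point instead of ['D_v f x], so
    the rules below compute it in closed form while they prove continuity. *)
Definition has_C1_deriv A (f : V -> R) (f' : V -> V -> R) : Prop := forall x, A x ->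
  [/\ {for x, continuous f}, forall v, is_derive x v f (f' v x) &
      forall v, {for x, continuous (f' v)}].

Lemma near_eq_continuous (T : topologicalType) (X : topologicalType) (f g : T -> X) x :
  (\forall y \near x, f y = g y) -> {for x, continuous f} -> {for x, continuous g}.
Proof.
move=> fg fx; have fgx := nbhs_singleton fg.
by move: fx; rewrite /prop_for /continuous_at fgx; apply: cvg_trans; exact: near_eq_cvg.
Qed.

Lemma C1_deriv_ext A (f g : V -> R) (f' g' : V -> V -> R) : f =1 g -> (forall v, f' v =1 g' v) ->
  has_C1_deriv A f f' -> has_C1_deriv A g g'.
Proof.
move=> fg fg'; have -> : g = f by exact/esym/funext.
by have -> : g' = f' by apply/funext => v; exact/esym/funext.
Qed.

Lemma C1_deriv_eq_in A (f g : V -> R) f' : open A -> {in A, f =1 g} ->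
  has_C1_deriv A f f' -> has_C1_deriv A g f'.
Proof.
move=> oA fg fA x Ax; have [fx dfx cfx] := fA x Ax.
have fgx : \forall y \near x, f y = g y.
  by apply: filterS (open_nbhs_nbhs (conj oA Ax)) => y Ay; apply: fg; rewrite inE.
split=> // [|v]; first exact: near_eq_continuous fx.
exact: near_eq_is_derive (dfx v).
Qed.

Lemma C1_deriv_cst A c : has_C1_deriv A (fun=> c) (fun _ _ => 0).
Proof.
by move=> x _; split=> [|v|v]; [exact: cvg_cst|exact: is_derive_cst|exact: cvg_cst].
Qed.

Lemma C1_derivD A f g f' g' : has_C1_deriv A f f' -> has_C1_deriv A g g' ->
  has_C1_deriv A (fun x => f x + g x) (fun v x => f' v x + g' v x).
Proof.
move=> fA gA x Ax; have [fx dfx cfx] := fA x Ax; have [gx dgx cgx] := gA x Ax.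
split=> [|v|v]; [exact: cvgD|exact: is_deriveD|exact: (cvgD (cfx v) (cgx v))].
Qed.

Lemma C1_derivM A f g f' g' : has_C1_deriv A f f' -> has_C1_deriv A g g' ->
  has_C1_deriv A (fun x => f x * g x) (fun v x => f' v x * g x + f x * g' v x).
Proof.
move=> fA gA x Ax; have [fx dfx cfx] := fA x Ax; have [gx dgx cgx] := gA x Ax.
split=> [|v|v]; first exact: cvgM.
  have [dfv dgv] := (dfx v, dgx v).
  apply: (is_derive_eq (is_deriveM dfv dgv)).
  by rewrite addrC mulrC.
by apply: cvgD; apply: cvgM => //; [exact: cfx|exact: cgx].
Qed.

Lemma C1_derivZ A c f f' : has_C1_deriv A f f' ->
  has_C1_deriv A (fun x => c * f x) (fun v x => c * f' v x).
Proof.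
move=> fA; have := C1_derivM (@C1_deriv_cst A c) fA.
by apply: C1_deriv_ext => // v x; rewrite mul0r add0r.
Qed.

Lemma C1_deriv_sum A (I : Type) (s : seq I) (f : I -> V -> R) (f' : I -> V -> V -> R) :
  (forall i, has_C1_deriv A (f i) (f' i)) ->
  has_C1_deriv A (fun x => \sum_(i <- s) f i x) (fun v x => \sum_(i <- s) f' i v x).
Proof.
move=> fA; elim: s => [|i s IH].
  apply: C1_deriv_ext (@C1_deriv_cst A 0) => [x|v x]; by rewrite big_nil.
apply: C1_deriv_ext (C1_derivD (fA i) IH) => [x|v x]; by rewrite big_cons.
Qed.

(** Restricted to the line through [x] along [v], [f] is a function of one real variable, and the
    one-variable chain rule applies. *)
Lemma is_derive_comp_dir (g : R -> R) (f : V -> R) x v (dg df : R) :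
  is_derive (f x) 1 g dg -> is_derive x v f df -> is_derive x v (fun y => g (f y)) (dg * df).
Proof.
move=> gx fx.
have dE (k : V -> R) : 'D_v k x = derive1 (fun h : R => k (h *: v + x)) 0.
  have E : (fun h : R => h^-1 *: ((k \o shift x) (h *: v) - k x)) =
      (fun h : R => h^-1 *: (((fun h : R => k (h *: v + x)) \o shift 0) (h *: (1 : R))
         - k (0 *: v + x))).
    by apply/funext => h /=; rewrite addr0 [h *: 1]mulr1 scale0r add0r.
  by rewrite derive1E /derive E.
have gd : derivable g (f x) 1 by exact: ex_derive.
have fd : derivable f x v by exact: ex_derive.
split; first exact: derivable_comp_dir.
rewrite dE -[X in derive1 X]/(g \o (fun h : R => f (h *: v + x))) derive1_comp.
- by rewrite -dE derive_val scale0r add0r derive1E derive_val.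
- exact: (derivable1P _ _ _).1 fd.
- by rewrite scale0r add0r.
Qed.

Lemma C1_deriv_comp A (f : V -> R) f' (g g' : R -> R) :
  (forall y : R, is_derive y 1 g (g' y)) -> continuous g' -> has_C1_deriv A f f' ->
  has_C1_deriv A (fun x => g (f x)) (fun v x => g' (f x) * f' v x).
Proof.
move=> dg cg' fA x Ax; have [fx dfx cfx] := fA x Ax.
split=> [|v|v].
- apply: (@continuous_comp _ _ _ f g) => //.
  by apply: differentiable_continuous; apply/derivable1_diffP; exact: ex_derive.
- exact: is_derive_comp_dir.
- apply: cvgM; last exact: cfx.
  by apply: (@continuous_comp _ _ _ f g') => //; exact: cg'.
Qed.

Lemma Ck_on_C1_deriv A (f : V -> R) : Ck_on 1 A f -> has_C1_deriv A f (fun v => 'D_v f).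
Proof.
move=> fC x Ax; have [/(_ x Ax) cf /(_ isT) df] := fC [::] isT.
split=> [//|v|v]; first exact/derivableP/df.
by have [/(_ x Ax)] := fC [:: v] isT.
Qed.

Definition has_C1_deriv_row n A (U : V -> 'rV[R]_n) (U' : V -> V -> 'rV[R]_n) : Prop :=
  forall k, has_C1_deriv A (fun x => U x 0 k) (fun v x => U' v x 0 k).

Lemma Ck_on_C1_deriv_row n A (U : V -> 'rV[R]_n) :
  Ck_on 1 A U -> has_C1_deriv_row A U (fun v => 'D_v U).
Proof.
move=> UC k x Ax; have [/(_ x Ax) cU /(_ isT) dU] := UC [::] isT.
have ck (G : V -> 'rV[R]_n) : {for x, continuous G} -> {for x, continuous (fun y => G y 0 k)}.
  move=> cG; apply: (@continuous_comp _ _ _ G (fun u : 'rV[R]_n => u 0 k)) => //.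
  exact: coord_continuous.
split=> [|v|v]; first exact: ck.
- have dUv := dU x v Ax; split; first exact: (derivable_mxP _ _ _).1.
  by rewrite derive_mx// mxE.
- by apply: ck; have [/(_ x Ax)] := UC [:: v] isT.
Qed.

(** As [A] is open, [f' v] and ['D_v f] agree near each point of [A], so continuity passes from the
    first to the second. *)
Lemma C1_deriv_Ck_on A f f' : open A -> has_C1_deriv A f f' -> Ck_on 1 A f.
Proof.
move=> oA fA [|v [|? ?]]//= _; split=> //.
- by move=> x Ax; have [] := fA x Ax.
- by move=> _ x v Ax; have [_ /(_ v) []] := fA x Ax.
move=> x Ax; have [_ _ /(_ v)] := fA x Ax; apply: near_eq_continuous.
  apply: filterS (open_nbhs_nbhs (conj oA Ax)) => y Ay.
  by have [_ /(_ v)[]] := fA y Ay.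
Qed.

Lemma C1_deriv_row_Ck_on n A (U : V -> 'rV[R]_n) U' : open A ->
  has_C1_deriv_row A U U' -> Ck_on 1 A U.
Proof.
move=> oA UA.
have dU x v : A x -> derivable U x v.
  by move=> Ax; apply/derivable_mxP => i j; rewrite ord1; have [_ /(_ v)[]] := UA j x Ax.
case=> [|v [|? ?]] svs; last by [].
  split=> [x Ax|_ x v Ax]; last exact: dU.
  by apply: continuous_row => j; have [] := UA j x Ax.
split=> [x Ax|lt11]; last by exfalso; move: lt11; rewrite ltnn.
apply: continuous_row => j; have [_ _ /(_ v)] := UA j x Ax.
apply: near_eq_continuous.
have nA : \forall y \near x, A y by exact: open_nbhs_nbhs (conj oA Ax).
apply: filterS nA => y Ay.
have [_ /(_ v) dUj _] := UA j y Ay.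
rewrite /iter_derive/= derive_mx; last exact: dU.
by rewrite mxE; have [_ ->] := dUj.
Qed.

Lemma C1_deriv_Ck_on2 A f f' (f'' : V -> V -> V -> R) : open A ->
  has_C1_deriv A f f' -> (forall v, has_C1_deriv A (f' v) (f'' v)) -> Ck_on 2 A f.
Proof.
move=> oA fA fA' vs svs.
have DA v : has_C1_deriv A ('D_v f) (f'' v).
  apply: C1_deriv_eq_in (fA' v) => // x; rewrite inE => Ax.
  by have [_ /(_ v)[]] := fA x Ax.
have atA g g' v : has_C1_deriv A g g' -> (forall x, A x -> {for x, continuous g}) /\
    (forall x, A x -> derivable g x v) /\ (forall x, A x -> {for x, continuous ('D_v g)}).
  move=> gA; have [cg dg] := C1_deriv_Ck_on oA gA (isT : (size [::] <= 1)%N).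
  have [cg' _] := C1_deriv_Ck_on oA gA (isT : (size [:: v] <= 1)%N).
  by split=> [|]; [exact: cg|split=> [x Ax|]; [exact: dg|exact: cg']].
case: vs svs => [|b [|c [|? ?]]] svs; last by [].
- by split; [exact: (atA _ _ 0 fA).1|move=> _ x v; exact: (atA _ _ v fA).2.1].
- by split; [exact: (atA _ _ 0 (DA b)).1|move=> _ x v; exact: (atA _ _ v (DA b)).2.1].
split=> [|lt11]; last by exfalso; move: lt11; rewrite ltnn.
exact: (atA _ _ b (DA c)).2.2.
Qed.

Lemma C1_deriv_dotp n A (p q : V -> 'rV[R]_n) p' q' :
  has_C1_deriv_row A p p' -> has_C1_deriv_row A q q' ->
  has_C1_deriv A (fun x => dotp (p x) (q x))
    (fun v x => dotp (p' v x) (q x) + dotp (p x) (q' v x)).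
Proof.
move=> pA qA; apply: C1_deriv_ext (C1_deriv_sum (index_enum 'I_n)
  (fun i => C1_derivM (pA i) (qA i))) => // v x.
by rewrite big_split.
Qed.

End C1_calculus.

(** * Components of the state vector and their derivatives *)

Section state_calculus.
Context {R : realType} {d : nat}.

Lemma dotp_state (u v : 'rV[R]_(sdim d)) : dotp u v = s_h u * s_h v + s_psi u * s_psi v
  + dotp (s_q u) (s_q v) + s_w u * s_w v + dotp (s_p u) (s_p v).
Proof.
rewrite /dotp /sdim big_split_ord big_ord1/= big_split_ord big_ord1/=.
rewrite big_split_ord/= big_split_ord big_ord1/= !addrA.
congr (_ + _ + _ + _ + _); rewrite /s_h /s_psi /s_q /s_w /s_p ?mxE//.
- by apply: eq_bigr => i _; rewrite !mxE.
- by apply: eq_bigr => i _; rewrite !mxE.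
Qed.

Lemma dotp_basis n (u : 'rV[R]_n) k : dotp u (basis_vec k) = u 0 k.
Proof.
rewrite /dotp (bigD1 k)//= mxE !eqxx mulr1 big1 ?addr0// => i ik.
by rewrite mxE (negbTE ik) andbF mulr0.
Qed.

Lemma dotpZl n a (u v : 'rV[R]_n) : dotp (a *: u) v = a * dotp u v.
Proof. by rewrite /dotp mulr_sumr; apply: eq_bigr => i _; rewrite mxE mulrA. Qed.

Lemma dotpZr n a (u v : 'rV[R]_n) : dotp u (a *: v) = a * dotp u v.
Proof. by rewrite /dotp mulr_sumr; apply: eq_bigr => i _; rewrite mxE mulrCA. Qed.

Lemma dotp0r n (u : 'rV[R]_n) : dotp u 0 = 0.
Proof. by rewrite /dotp big1// => i _; rewrite mxE mulr0. Qed.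

Lemma sqnorm_ge0 n (u : 'rV[R]_n) : 0 <= sqnorm u.
Proof. by apply: sumr_ge0 => i _; rewrite -expr2 sqr_ge0. Qed.

Lemma sqnorm_eq0 n (u : 'rV[R]_n) : sqnorm u = 0 -> u = 0.
Proof.
move=> u0; apply/rowP => i; rewrite mxE; apply/eqP; rewrite -sqrf_eq0 expr2.
apply/eqP; move: i (isT : true); apply: psumr_eq0P => // i _.
by rewrite -expr2 sqr_ge0.
Qed.

Lemma sqnormD n (u v : 'rV[R]_n) : sqnorm (u + v) = sqnorm u + 2 * dotp u v + sqnorm v.
Proof.
rewrite /sqnorm /dotp mulr_sumr -!big_split; apply: eq_bigr => i _ /=.
by rewrite !mxE; ring.
Qed.

Lemma mkstate_gt0 (a b e : R) (c f : 'rV[R]_d) k : 0 < a -> 0 < b -> 0 < e ->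
  (forall i, 0 < c 0 i) -> (forall i, 0 < f 0 i) -> 0 < mkstate a b c e f 0 k.
Proof.
move=> a0 b0 e0 c0 f0; rewrite /mkstate.
case: (split_ordP k) => i ->; first by rewrite row_mxEl ord1 mxE.
rewrite row_mxEr; case: (split_ordP i) => j ->; first by rewrite row_mxEl ord1 mxE.
rewrite row_mxEr; case: (split_ordP j) => l ->; first by rewrite row_mxEl.
rewrite row_mxEr; case: (split_ordP l) => m ->; first by rewrite row_mxEl ord1 mxE.
by rewrite row_mxEr.
Qed.

Section differentiable.
Context {V : normedModType R}.

Lemma differentiable_row n (f : V -> 'rV[R]_n) x :
  (forall k, differentiable (fun y => f y 0 k) x) -> differentiable f x.
Proof.
move=> df; have -> : f = \sum_(k < n) (fun y => f y 0 k *: (delta_mx 0 k : 'rV[R]_n)).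
  apply/funext => y; rewrite fct_sumE; exact: row_sum_delta.
by apply: differentiable_sum => k; exact: differentiableZl.
Qed.

Lemma differentiable_mkstate (h psi w : V -> R) (q p : V -> 'rV[R]_d) x :
  differentiable h x -> differentiable psi x ->
  (forall k, differentiable (fun y => q y 0 k) x) -> differentiable w x ->
  (forall k, differentiable (fun y => p y 0 k) x) ->
  differentiable (fun y => mkstate (h y) (psi y) (q y) (w y) (p y)) x.
Proof.
move=> dh dpsi dq dw dp; apply: differentiable_row => k; rewrite /mkstate.
case: (split_ordP k) => i ->.
  by under eq_fun do rewrite row_mxEl (ord1 i) mxE mulr1n.
under eq_fun do rewrite row_mxEr; case: (split_ordP i) => j ->.
  by under eq_fun do rewrite row_mxEl (ord1 j) mxE mulr1n.
under eq_fun do rewrite row_mxEr; case: (split_ordP j) => l ->.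
  by under eq_fun do rewrite row_mxEl; exact: dq.
under eq_fun do rewrite row_mxEr; case: (split_ordP l) => m ->.
  by under eq_fun do rewrite row_mxEl (ord1 m) mxE mulr1n.
by under eq_fun do rewrite row_mxEr; exact: dp.
Qed.

Section components.
Variables (A : set V) (U : V -> 'rV[R]_(sdim d)) (U' : V -> V -> 'rV[R]_(sdim d)).
Hypothesis UA : has_C1_deriv_row A U U'.

Lemma C1_deriv_s_h : has_C1_deriv A (fun x => s_h (U x)) (fun v x => s_h (U' v x)).
Proof. by apply: C1_deriv_ext (UA (lshift _ 0)) => [x|v x]; rewrite /s_h !mxE. Qed.

Lemma C1_deriv_s_psi : has_C1_deriv A (fun x => s_psi (U x)) (fun v x => s_psi (U' v x)).
Proof.
by apply: C1_deriv_ext (UA (rshift _ (lshift _ 0))) => [x|v x]; rewrite /s_psi !mxE.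
Qed.

Lemma C1_deriv_s_q : has_C1_deriv_row A (fun x => s_q (U x)) (fun v x => s_q (U' v x)).
Proof.
move=> k; apply: C1_deriv_ext (UA (rshift _ (rshift _ (lshift _ k)))) => [x|v x];
by rewrite /s_q !mxE.
Qed.

Lemma C1_deriv_s_w : has_C1_deriv A (fun x => s_w (U x)) (fun v x => s_w (U' v x)).
Proof.
by apply: C1_deriv_ext (UA (rshift _ (rshift _ (rshift _ (lshift _ 0))))) => [x|v x];
  rewrite /s_w !mxE.
Qed.

Lemma C1_deriv_s_p : has_C1_deriv_row A (fun x => s_p (U x)) (fun v x => s_p (U' v x)).
Proof.
move=> k; apply: C1_deriv_ext (UA (rshift _ (rshift _ (rshift _ (rshift _ k))))) => [x|v x];
by rewrite /s_p !mxE.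
Qed.

End components.
End differentiable.

(** Applied to the identity field, the chain rules stated for a field [U] become statements about
    functions of the state itself. *)
Lemma C1_deriv_row_id n (A : set 'rV[R]_n) : has_C1_deriv_row A id (fun v _ => v).
Proof.
move=> k x _; split=> [|v|v]; [exact: coord_continuous| |exact: (@cst_continuous _ _ (v 0 k) x)].
have dx : derivable (fun y : 'rV[R]_n => y 0 k) x v.
  by apply: diff_derivable; exact: differentiable_coord.
split=> //.
have dI : derivable (@id 'rV[R]_n) x v by exact: derivable_id.
have := derive_mx dI.
by rewrite derive_id => /rowP/(_ k); rewrite mxE.
Qed.

End state_calculus.

(** * Gradient and Hessian of the entropy, and compatibility with the flux *)

Section smooth_real.
Context {R : realType}.
Variable g : R -> R.
Hypothesis g_smooth : smooth g.

Lemma smooth_is_derive (h : R) : is_derive h 1 g (derive1 g h).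
Proof.
have [_ /(_ isT h 1 I) dh] := @g_smooth 1%N [::] isT.
by rewrite derive1E; exact: derivableP.
Qed.

Lemma smooth_derive1_continuous : continuous (derive1 g).
Proof.
have -> : derive1 g = 'D_1 g by apply/funext => h; rewrite derive1E.
by move=> h; have [cP _] := @g_smooth 1%N [:: 1] isT; exact: cP.
Qed.

Lemma smooth_continuous : continuous g.
Proof. by move=> h; have [cP _] := @g_smooth 0%N [::] isT; exact: cP. Qed.

End smooth_real.

Section entropy_calculus.
Context {R : realType} {d : nat}.
Variables (alpha beta gamma tau : R) (Pi W : R -> R).
Hypotheses (Pi_smooth : smooth Pi) (W_Pi : forall h : R, is_derive h 1 W (Pi h)).

Let E := entropy (d := d) alpha beta gamma tau W.
Let Q := entropy_flux (d := d) gamma Pi.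

Let dPi := smooth_is_derive Pi_smooth.
Let cdPi := smooth_derive1_continuous Pi_smooth.
Let cPi := smooth_continuous Pi_smooth.

Definition entropy_var (u : 'rV[R]_(sdim d)) : 'rV[R]_(sdim d) :=
  mkstate (Pi (s_h u)) (alpha^-1 * s_psi u) (tau *: s_q u) (beta * s_w u) (gamma *: s_p u).

Definition entropy_weight (u : 'rV[R]_(sdim d)) : 'rV[R]_(sdim d) :=
  mkstate (derive1 Pi (s_h u)) alpha^-1 (const_mx tau) beta (const_mx gamma).

Definition flux_deriv (j : 'I_d) (u v : 'rV[R]_(sdim d)) : R :=
  (derive1 Pi (s_h u) * s_h v + s_psi v) * s_q u 0 j
  + (Pi (s_h u) + s_psi u) * s_q v 0 j
  - gamma * (s_w v * s_p u 0 j + s_w u * s_p v 0 j).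

Section chain.
Context {V : normedModType R}.
Variables (A : set V) (U : V -> 'rV[R]_(sdim d)) (U' : V -> V -> 'rV[R]_(sdim d)).
Hypothesis UA : has_C1_deriv_row A U U'.

Let hA := C1_deriv_s_h UA.
Let psiA := C1_deriv_s_psi UA.
Let qA := C1_deriv_s_q UA.
Let wA := C1_deriv_s_w UA.
Let pA := C1_deriv_s_p UA.

Lemma entropy_C1 :
  has_C1_deriv A (fun x => E (U x)) (fun v x => dotp (entropy_var (U x)) (U' v x)).
Proof.
have := C1_derivD (C1_derivD (C1_derivD (C1_derivD (C1_deriv_comp W_Pi cPi hA)
  (C1_derivZ (2 * alpha)^-1 (C1_derivM psiA psiA)))
  (C1_derivZ (tau / 2) (C1_deriv_dotp qA qA)))
  (C1_derivZ (beta / 2) (C1_derivM wA wA)))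
  (C1_derivZ (gamma / 2) (C1_deriv_dotp pA pA)).
apply: C1_deriv_ext => [x|v x].
  by rewrite /E /entropy /sqnorm !expr2; ring.
rewrite dotp_state !s_h_mk !s_psi_mk !s_q_mk !s_w_mk !s_p_mk !dotpZl invfM.
have dC n (a b : 'rV[R]_n) : dotp a b = dotp b a.
  by apply: eq_bigr => i _; rewrite mulrC.
rewrite (dC _ (s_q (U' v x))) (dC _ (s_p (U' v x))).
(* Generalizing [alpha^-1] spares [field] the side condition [alpha != 0]. *)
by move: alpha^-1 => a; field.
Qed.

Lemma entropy_flux_C1 j :
  has_C1_deriv A (fun x => Q (U x) 0 j) (fun v x => flux_deriv j (U x) (U' v x)).
Proof.
have := C1_derivD (C1_derivM (C1_derivD (C1_deriv_comp dPi cdPi hA) psiA) (qA j))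
  (C1_derivZ (- gamma) (C1_derivM wA (pA j))).
apply: C1_deriv_ext => [x|v x]; first by rewrite /Q /entropy_flux !mxE; ring.
by rewrite /flux_deriv; ring.
Qed.

End chain.

Lemma entropy_C1_id (A : set 'rV[R]_(sdim d)) :
  has_C1_deriv A E (fun v u => dotp (entropy_var u) v).
Proof. exact: entropy_C1 (@C1_deriv_row_id R _ A). Qed.

(** This is the second derivative of the entropy. It is written over the raw coordinates [k], so
    that inserting basis vectors for [v] and [w] yields the entries of a diagonal matrix. *)
Lemma entropy_var_C1 (A : set 'rV[R]_(sdim d)) v :
  has_C1_deriv A (fun u => dotp (entropy_var u) v)
    (fun w u => \sum_k entropy_weight u 0 k * w 0 k * v 0 k).
Proof.
have idA := @C1_deriv_row_id R _ A.
have qv : has_C1_deriv_row A (fun=> s_q v) (fun _ _ => 0).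
  by move=> k; apply: C1_deriv_ext (@C1_deriv_cst R _ A (s_q v 0 k)) => // w u; rewrite mxE.
have pv : has_C1_deriv_row A (fun=> s_p v) (fun _ _ => 0).
  by move=> k; apply: C1_deriv_ext (@C1_deriv_cst R _ A (s_p v 0 k)) => // w u; rewrite mxE.
have := C1_derivD (C1_derivD (C1_derivD (C1_derivD
  (C1_derivZ (s_h v) (C1_deriv_comp dPi cdPi (C1_deriv_s_h idA)))
  (C1_derivZ (alpha^-1 * s_psi v) (C1_deriv_s_psi idA)))
  (C1_derivZ tau (C1_deriv_dotp (C1_deriv_s_q idA) qv)))
  (C1_derivZ (beta * s_w v) (C1_deriv_s_w idA)))
  (C1_derivZ gamma (C1_deriv_dotp (C1_deriv_s_p idA) pv)).
apply: C1_deriv_ext => [u|w u].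
  rewrite dotp_state !s_h_mk !s_psi_mk !s_q_mk !s_w_mk !s_p_mk !dotpZl; ring.
rewrite !dotp0r !addr0.
have -> : \sum_k entropy_weight u 0 k * w 0 k * v 0 k =
    dotp (\row_k (entropy_weight u 0 k * w 0 k)) v.
  by apply: eq_bigr => k _; rewrite [in RHS]mxE.
rewrite dotp_state.
have -> : s_h (\row_k (entropy_weight u 0 k * w 0 k)) = s_h (entropy_weight u) * s_h w.
  by rewrite /s_h !mxE.
have -> : s_psi (\row_k (entropy_weight u 0 k * w 0 k)) = s_psi (entropy_weight u) * s_psi w.
  by rewrite /s_psi !mxE.
have -> : s_w (\row_k (entropy_weight u 0 k * w 0 k)) = s_w (entropy_weight u) * s_w w.
  by rewrite /s_w !mxE.
have -> : s_q (\row_k (entropy_weight u 0 k * w 0 k)) = tau *: s_q w.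
  apply/rowP => j; have := congr1 (fun q : 'rV[R]_d => q 0 j)
    (s_q_mk (derive1 Pi (s_h u)) alpha^-1 beta (const_mx tau) (const_mx gamma)).
  by rewrite -/(entropy_weight u) /s_q !mxE => ->.
have -> : s_p (\row_k (entropy_weight u 0 k * w 0 k)) = gamma *: s_p w.
  apply/rowP => j; have := congr1 (fun q : 'rV[R]_d => q 0 j)
    (s_p_mk (derive1 Pi (s_h u)) alpha^-1 beta (const_mx tau) (const_mx gamma)).
  by rewrite -/(entropy_weight u) /s_p !mxE => ->.
rewrite /entropy_weight s_h_mk s_psi_mk s_w_mk !dotpZl; ring.
Qed.

Lemma derive_entropy (v : 'rV[R]_(sdim d)) : 'D_v E = (fun u => dotp (entropy_var u) v).
Proof. by apply/funext => u; have [_ /(_ v)[]] := @entropy_C1_id setT u I. Qed.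

Lemma grad_entropy u : grad E u = entropy_var u.
Proof.
apply/rowP => k; rewrite [LHS]mxE -dotp_basis.
by have [_ /(_ (basis_vec k))[]] := @entropy_C1_id setT u I.
Qed.

Lemma hessian_entropy u : hessian E u = diag_mx (entropy_weight u).
Proof.
apply/matrixP => i j; rewrite !mxE derive_entropy.
have [_ /(_ (basis_vec i))[_ ->] _] := @entropy_var_C1 setT (basis_vec j) u I.
rewrite (bigD1 i)//= big1 ?addr0 => [|k ki].
  by rewrite !mxE !eqxx/= mulr1; case: eqP => _; rewrite ?mulr1 ?mulr0.
by rewrite !mxE (negbTE ki) andbF mulr0 mul0r.
Qed.

Lemma state_space_open : open (@state_space R d).
Proof.
have ch : continuous (@s_h R d).
  by move=> u; have [] := C1_deriv_s_h (@C1_deriv_row_id R _ setT) (I : setT u).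
have -> : @state_space R d = @s_h R d @^-1` [set x | 0 < x] by [].
by apply: open_comp; [move=> u _; exact: ch|exact: open_gt].
Qed.

Lemma entropy_Ck : Ck_on 2 (@state_space R d) E.
Proof.
apply: (C1_deriv_Ck_on2 state_space_open (@entropy_C1_id _)) => v.
exact: entropy_var_C1.
Qed.

Lemma entropy_flux_Ck : Ck_on 1 (@state_space R d) Q.
Proof.
apply: (C1_deriv_row_Ck_on state_space_open (U' := fun v u => \row_j flux_deriv j u v)) => j.
apply: C1_deriv_ext (entropy_flux_C1 (@C1_deriv_row_id R _ _) j) => // v u.
by rewrite mxE.
Qed.

(** The factors [alpha], [tau^-1] and [gamma / beta] of the flux cancel against [alpha^-1], [tau]
    and [beta] in the gradient of the entropy. What remains is the product rule for
    [(Pi(h) + psi) q_j - gamma w p_j]. *)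
Lemma flux_compat u j : beta != 0 -> tau != 0 -> alpha != 0 ->
  grad E u *m Dmx (flux alpha beta gamma tau Pi j) u = grad (fun v => Q v 0 j) u.
Proof.
move=> b0 t0 a0; rewrite grad_entropy.
have idA := @C1_deriv_row_id R (sdim d) setT.
(* The Jacobian represents directional derivatives where the map is differentiable, so
   differentiability of the flux is assembled from its components first. *)
have dcst c : differentiable (fun _ : 'rV[R]_(sdim d) => c : R) u by exact: differentiable_cst.
have dh : differentiable (@s_h R d) u.
  have -> : @s_h R d = (fun v => v 0 (lshift _ 0)) by apply/funext => v; rewrite /s_h mxE.
  exact: differentiable_coord.
have dpsi : differentiable (@s_psi R d) u.
  have -> : @s_psi R d = (fun v => v 0 (rshift _ (lshift _ 0))).
    by apply/funext => v; rewrite /s_psi !mxE.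
  exact: differentiable_coord.
have dw : differentiable (@s_w R d) u.
  have -> : @s_w R d = (fun v => v 0 (rshift _ (rshift _ (rshift _ (lshift _ 0))))).
    by apply/funext => v; rewrite /s_w !mxE.
  exact: differentiable_coord.
have dq : differentiable (fun v : 'rV[R]_(sdim d) => s_q v 0 j) u.
  have -> : (fun v => s_q v 0 j) =
      (fun v : 'rV[R]_(sdim d) => v 0 (rshift _ (rshift _ (lshift _ j)))).
    by apply/funext => v; rewrite /s_q !mxE.
  exact: differentiable_coord.
have dp : differentiable (fun v : 'rV[R]_(sdim d) => s_p v 0 j) u.
  have -> : (fun v => s_p v 0 j) =
      (fun v : 'rV[R]_(sdim d) => v 0 (rshift _ (rshift _ (rshift _ (rshift _ j))))).
    by apply/funext => v; rewrite /s_p !mxE.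
  exact: differentiable_coord.
have dr : differentiable (fun v : 'rV[R]_(sdim d) => (Pi (s_h v) + s_psi v) / tau) u.
  apply: differentiableM => //; apply: differentiableD => //.
  apply: (differentiable_comp dh); apply/derivable1_diffP; exact: ex_derive.
have dF : differentiable (flux alpha beta gamma tau Pi j) u.
  apply: differentiable_mkstate => // [|k||k].
  - exact: differentiableM.
  - by under eq_fun do rewrite mxE; exact: differentiableM.
  - exact: differentiableM.
  - by under eq_fun do rewrite !mxE; apply: differentiableM => //; exact: differentiableN.
apply/rowP => k; rewrite [RHS]mxE.
have [_ /(_ (basis_vec k))[_ ->] _] := entropy_flux_C1 idA j (I : setT u).
transitivity (dotp (entropy_var u) ('D_(basis_vec k) (flux alpha beta gamma tau Pi j) u)).
  rewrite [LHS]mxE; apply: eq_bigr => i _; congr (_ * _).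
  rewrite deriveEjacobian// !mxE (bigD1 k)//= big1 ?addr0 => [|l lk].
    by rewrite !mxE !eqxx mul1r.
  by rewrite !mxE (negbTE lk) andbF mul0r.
set v := basis_vec k; rewrite /flux.
have drv : derivable (fun v : 'rV[R]_(sdim d) => (Pi (s_h v) + s_psi v) / tau) u v.
  exact: diff_derivable.
have dwv : derivable (fun v : 'rV[R]_(sdim d) => - s_w v) u v.
  by apply: diff_derivable; exact: differentiableN.
rewrite derive_mkstate; first last.
- exact: derivable_scale.
- by apply: diff_derivable; exact: differentiableM.
- exact: derivable_scale.
- by apply: diff_derivable; exact: differentiableM.
- exact: diff_derivable.
rewrite !derive_scale//.
have [_ /(_ v)[_ Dq] _] := C1_deriv_s_q idA j (I : setT u).
have [_ /(_ v)[_ Daq] _] := C1_derivZ alpha (C1_deriv_s_q idA j) (I : setT u).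
have [_ /(_ v)[_ Dp] _] := C1_derivZ (- (gamma / beta)) (C1_deriv_s_p idA j) (I : setT u).
have [_ /(_ v)[_ Dw] _] := C1_derivZ (- 1) (C1_deriv_s_w idA) (I : setT u).
have [_ /(_ v)[_ Dr] _] := C1_derivZ tau^-1
  (C1_derivD (C1_deriv_comp dPi cdPi (C1_deriv_s_h idA)) (C1_deriv_s_psi idA)) (I : setT u).
have -> : (fun v : 'rV[R]_(sdim d) => (Pi (s_h v) + s_psi v) / tau) =
    (fun v => tau^-1 * (Pi (s_h v) + s_psi v)) by apply/funext => y; rewrite mulrC.
have -> : (fun v : 'rV[R]_(sdim d) => - s_w v) = (fun v => - 1 * s_w v).
  by apply/funext => y; rewrite mulN1r.
rewrite Dq Daq Dp Dw Dr dotp_state !s_h_mk !s_psi_mk !s_q_mk !s_w_mk !s_p_mk.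
rewrite !dotpZl !dotpZr !dotp_basis /flux_deriv.
by field; rewrite a0 b0 t0.
Qed.

End entropy_calculus.

(** * Strict convexity of the entropy and positivity of its Hessian *)

Section entropy_convexity.
Context {R : realType} {d : nat}.
Variables (alpha beta gamma tau delta : R) (Pi W : R -> R).
Hypotheses (alpha_gt0 : 0 < alpha) (beta_gt0 : 0 < beta).
Hypotheses (gamma_gt0 : 0 < gamma) (tau_gt0 : 0 < tau) (delta_gt0 : 0 < delta).
Hypotheses (Pi_smooth : smooth Pi) (W_Pi : forall h : R, is_derive h 1 W (Pi h)).
Hypothesis Pi'_ge : forall h : R, 0 <= h -> delta <= derive1 Pi h.

Let E := entropy (d := d) alpha beta gamma tau W.
Let ev := entropy_var (d := d) alpha beta gamma tau Pi.

Let is_derive_within (f f' : R -> R) a b : (forall x : R, is_derive x 1 f (f' x)) ->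
  {within `[a, b], continuous f}.
Proof.
move=> df; apply: continuous_subspaceT => x.
by apply: differentiable_continuous; apply/derivable1_diffP; exact: ex_derive.
Qed.

Lemma Pi_increasing a b : 0 <= a -> a < b -> Pi a < Pi b.
Proof.
move=> a0 ab; have dPi := smooth_is_derive Pi_smooth.
have [c] := MVT ab (fun x _ => dPi x) (is_derive_within dPi).
rewrite in_itv/= => /andP[ac cb] Pab.
by rewrite -subr_gt0 Pab mulr_gt0 ?subr_gt0// (lt_le_trans delta_gt0)//
  Pi'_ge// (le_trans a0 (ltW ac)).
Qed.

Lemma W_tangent a b : 0 <= a -> 0 <= b -> a != b -> W a + Pi a * (b - a) < W b.
Proof.
move=> a0 b0; rewrite neq_lt => /orP[ab|ba].
  have [c] := MVT ab (fun x _ => W_Pi x) (is_derive_within W_Pi).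
  rewrite in_itv/= => /andP[ac cb] Wab.
  have Pac := Pi_increasing a0 ac.
  have : Pi a * (b - a) < Pi c * (b - a) by rewrite ltr_pM2r// subr_gt0.
  by lra.
have [c] := MVT ba (fun x _ => W_Pi x) (is_derive_within W_Pi).
rewrite in_itv/= => /andP[bc ca] Wba.
have Pca := Pi_increasing (le_trans b0 (ltW bc)) ca.
have : Pi c * (a - b) < Pi a * (a - b) by rewrite ltr_pM2r// subr_gt0.
by lra.
Qed.

(** The quadratic part of the entropy equals its tangent plus its value at the increment, so the gap
    is the gap of [W] plus nonnegative squares. The proof is by contraposition, as it is not known
    which component of [w] is nonzero: a nonpositive gap forces every term, hence every component,
    to vanish. *)
Lemma entropy_tangent (u w : 'rV[R]_(sdim d)) : 0 <= s_h u -> 0 <= s_h (u + w) -> w != 0 ->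
  E u + dotp (ev u) w < E (u + w).
Proof.
move=> u0 uw0; apply: contra_neqT; rewrite -leNgt => Euw.
have Wle : W (s_h u) + Pi (s_h u) * s_h w <= W (s_h (u + w)).
  have [hw|hw] := eqVneq (s_h w) 0; first by rewrite s_hD hw mulr0 !addr0.
  have := @W_tangent (s_h u) (s_h (u + w)) u0 uw0.
  rewrite s_hD [_ + s_h w - _]addrC addKr => Wlt; apply: ltW; apply: Wlt.
  by apply: contra hw => /eqP; lra.
have psi0 := sqr_ge0 (s_psi w); have w0 := sqr_ge0 (s_w w).
have q0 := sqnorm_ge0 (s_q w); have p0 := sqnorm_ge0 (s_p w).
have gap : E (u + w) - (E u + dotp (ev u) w) =
    (W (s_h (u + w)) - (W (s_h u) + Pi (s_h u) * s_h w))
    + alpha^-1 / 2 * s_psi w ^+ 2 + tau / 2 * sqnorm (s_q w)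
    + beta / 2 * s_w w ^+ 2 + gamma / 2 * sqnorm (s_p w).
  rewrite /E /entropy /ev dotp_state !s_h_mk !s_psi_mk !s_q_mk !s_w_mk !s_p_mk.
  rewrite !dotpZl s_psiD s_qD s_wD s_pD !sqnormD invfM.
  by move: alpha^-1 => a; field.
have a2 : 0 < alpha^-1 / 2 by rewrite divr_gt0// invr_gt0.
have t2 : 0 < tau / 2 by rewrite divr_gt0.
have b2 : 0 < beta / 2 by rewrite divr_gt0.
have g2 : 0 < gamma / 2 by rewrite divr_gt0.
have := mulr_ge0 (ltW a2) psi0; have := mulr_ge0 (ltW t2) q0.
have := mulr_ge0 (ltW b2) w0; have := mulr_ge0 (ltW g2) p0 => P4 P3 P2 P1.
have h0 : s_h w = 0.
  apply/eqP; apply: contraT => hw.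
  have := @W_tangent (s_h u) (s_h (u + w)) u0 uw0.
  rewrite s_hD [_ + s_h w - _]addrC addKr -s_hD => Wlt.
  have /Wlt : s_h u != s_h (u + w).
    by rewrite s_hD; apply: contra hw => /eqP; lra.
  by lra.
have /eqP : alpha^-1 / 2 * s_psi w ^+ 2 = 0 by lra.
rewrite mulf_eq0 (gt_eqF a2)/= sqrf_eq0 => /eqP psi_eq0.
have /eqP : beta / 2 * s_w w ^+ 2 = 0 by lra.
rewrite mulf_eq0 (gt_eqF b2)/= sqrf_eq0 => /eqP w_eq0.
have /eqP : tau / 2 * sqnorm (s_q w) = 0 by lra.
rewrite mulf_eq0 (gt_eqF t2)/= => /eqP/sqnorm_eq0 q_eq0.
have /eqP : gamma / 2 * sqnorm (s_p w) = 0 by lra.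
rewrite mulf_eq0 (gt_eqF g2)/= => /eqP/sqnorm_eq0 p_eq0.
apply/state_eqP; rewrite h0 psi_eq0 q_eq0 w_eq0 p_eq0 /s_h /s_psi /s_q /s_w /s_p.
by rewrite !linear0 !mxE.
Qed.

Lemma entropy_strictly_convex : strictly_convex_on (@state_space R d) E.
Proof.
move=> x y Gx Gy xy s /andP[s0 s1]; set m := s *: x + (1 - s) *: y.
have Gm : 0 <= s_h m.
  have sZ a (z : 'rV[R]_(sdim d)) : s_h (a *: z) = a * s_h z.
    by rewrite /s_h linearZ/= mxE.
  by rewrite s_hD !sZ addr_ge0// mulr_ge0// ?subr_ge0; apply: ltW.
(* Both tangent inequalities are taken at [m]; the increments towards [x] and [y], weighted by [s]
   and [1 - s], add up to zero, so the linear terms cancel. *)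
have xm : x = m + (1 - s) *: (x - y).
  by apply/rowP => i; rewrite /m !mxE; ring.
have ym : y = m + (- s) *: (x - y).
  by apply/rowP => i; rewrite /m !mxE; ring.
have xy0 : x - y != 0 by rewrite subr_eq0; apply/eqP.
have := @entropy_tangent m ((1 - s) *: (x - y)) Gm.
rewrite -xm dotpZr => /(_ (ltW Gx)) Ex.
have := @entropy_tangent m ((- s) *: (x - y)) Gm.
rewrite -ym dotpZr => /(_ (ltW Gy)) Ey.
have {}Ex := Ex (ltac:(rewrite scaler_eq0 negb_or xy0 andbT subr_eq0 gt_eqF//)).
have {}Ey := Ey (ltac:(rewrite scaler_eq0 negb_or xy0 andbT oppr_eq0 gt_eqF//)).
have s1' : 0 < 1 - s by rewrite subr_gt0.
have -> : E m = s * (E m + (1 - s) * dotp (ev m) (x - y))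
    + (1 - s) * (E m + - s * dotp (ev m) (x - y)) by ring.
by rewrite ltrD// ltr_pM2l.
Qed.

Lemma entropy_convex_function : convex_function (@state_space R d) (E : _ -> R^o).
Proof.
move=> t x y; rewrite !inE => Gx Gy; rewrite convRE.
have -> : conv t x y = t%:num *: (x : 'rV[R]_(sdim d)) + (1 - t%:num) *: (y : 'rV[R]_(sdim d)).
  by [].
have t0 : 0 <= t%:num := ge0 t; have t1 : t%:num <= 1 := le1 t.
rewrite /unstable.onem; move: (t%:num) t0 t1 => {}t.
(* Strict convexity excludes [t = 0], [t = 1] and [x = y], where the two sides are equal. *)
move=> t0 t1; have [->|tn0] := eqVneq t 0.
  by rewrite !subr0 scale0r scale1r mul0r mul1r !add0r.
have [->|tn1] := eqVneq t 1.
  by rewrite !subrr scale0r scale1r mul0r mul1r !addr0.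
have [->|/eqP xy] := eqVneq (x : 'rV[R]_(sdim d)) y.
  by rewrite -scalerDl -mulrDl addrC subrK scale1r mul1r.
by apply/ltW/entropy_strictly_convex => //; rewrite !lt_neqAle t0 t1 tn1 eq_sym tn0.
Qed.

Lemma entropy_weight_gt0 u k : state_space u ->
  0 < entropy_weight (d := d) alpha beta gamma tau Pi u 0 k.
Proof.
move=> Gu; apply: mkstate_gt0; rewrite ?invr_gt0//.
- by rewrite (lt_le_trans delta_gt0)// Pi'_ge// ltW.
- by move=> i; rewrite mxE.
- by move=> i; rewrite mxE.
Qed.

Lemma diag_posdef n (c : 'rV[R]_n) : (forall k, 0 < c 0 k) -> posdefmx (diag_mx c).
Proof.
move=> c0; split=> [|v v0]; first exact: tr_diag_mx.
have -> : (v *m diag_mx c *m v^T) 0 0 = \sum_k c 0 k * v 0 k ^+ 2.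
  rewrite mul_mx_diag mxE; apply: eq_bigr => k _; rewrite !mxE; ring.
have ge0 k : 0 <= c 0 k * v 0 k ^+ 2 by rewrite mulr_ge0 ?sqr_ge0// ltW.
rewrite lt_neqAle sumr_ge0 ?andbT//; apply: contra v0 => /eqP/esym s0.
apply/eqP/rowP => k; rewrite mxE; apply/eqP; rewrite -sqrf_eq0.
have /eqP : c 0 k * v 0 k ^+ 2 = 0.
  by move: k (isT : true); apply: psumr_eq0P => // k _; exact: ge0.
by rewrite mulf_eq0 (gt_eqF (c0 k)).
Qed.

Lemma hessian_posdef u : state_space u -> posdefmx (hessian E u).
Proof.
move=> Gu; rewrite hessian_entropy//; apply: diag_posdef => k.
exact: entropy_weight_gt0.
Qed.

End entropy_convexity.

(** * Entropy balance along classical solutions *)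

Section solutions.
Context {R : realType} {d : nat}.
Variables (alpha beta gamma tau m0 : R) (M Pi W : R -> R).
Hypotheses (m0_gt0 : 0 < m0) (M_smooth : smooth M).
Hypothesis M_gt : forall h : R, 0 <= h -> m0^-1 < M h.
Hypotheses (Pi_smooth : smooth Pi) (W_Pi : forall h : R, is_derive h 1 W (Pi h)).

Let E := entropy (d := d) alpha beta gamma tau W.
Let Q := entropy_flux (d := d) gamma Pi.
Let ev := entropy_var (d := d) alpha beta gamma tau Pi.
Let fd := flux_deriv (d := d) gamma Pi.

Definition dissipation (u : 'rV[R]_(sdim d)) : R := sqnorm (s_q u) / M (s_h u).

Let M_gt0 h : 0 <= h -> 0 < M h.
Proof. by move=> h0; apply: lt_trans (M_gt h0); rewrite invr_gt0. Qed.

Lemma dissipation_ge0 u : state_space u -> 0 <= dissipation u.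
Proof. by move=> Gu; rewrite divr_ge0 ?sqnorm_ge0// ltW// M_gt0// ltW. Qed.

Lemma dissipation_continuous u : state_space u -> {for u, continuous dissipation}.
Proof.
move=> Gu; have idA := @C1_deriv_row_id R (sdim d) setT.
have [cq _ _] := C1_deriv_dotp (C1_deriv_s_q idA) (C1_deriv_s_q idA) (I : setT u).
have [ch _ _] := C1_deriv_s_h idA (I : setT u).
have Mu : M (s_h u) != 0 by rewrite gt_eqF// M_gt0// ltW.
have cM : {for u, continuous (fun u => M (s_h u))}.
  by apply: (@continuous_comp _ _ _ (@s_h R d) M) => //; exact: smooth_continuous.
have cMV : {for u, continuous (fun u => (M (s_h u))^-1)}.
  apply: (@continuous_comp _ _ _ (fun u => M (s_h u)) (@GRing.inv R)) => //.
  exact: inv_continuous.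
exact: (cvgM cq cMV).
Qed.

(* The source terms [- psi w] and [w psi] of the second and fourth equations
   cancel, which leaves only the friction term. *)
Lemma entropy_identity (u ut : 'rV[R]_(sdim d)) (ux : 'I_d -> 'rV[R]_(sdim d)) :
  s_h ut + \sum_j s_q (ux j) 0 j = 0 ->
  alpha^-1 * s_psi ut + \sum_j s_q (ux j) 0 j = - s_w u ->
  (forall j, tau * s_q ut 0 j + (derive1 Pi (s_h u) * s_h (ux j) + s_psi (ux j))
     = - (M (s_h u))^-1 * s_q u 0 j) ->
  beta * s_w ut - gamma * \sum_j s_p (ux j) 0 j = s_psi u ->
  (forall j, s_p ut 0 j - s_w (ux j) = 0) ->
  dotp (ev u) ut + \sum_j fd j u (ux j) = - dissipation u.
Proof.
move=> e1 e2 e3 e4 e5.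
rewrite dotp_state !s_h_mk !s_psi_mk !s_q_mk !s_w_mk !s_p_mk !dotpZl /dissipation.
set a := \sum_j _ in e1 e2; set b := \sum_j _ in e4.
have -> : \sum_j fd j u (ux j) =
  \sum_j (derive1 Pi (s_h u) * s_h (ux j) + s_psi (ux j)) * s_q u 0 j
  + (Pi (s_h u) + s_psi u) * a - gamma * \sum_j s_w (ux j) * s_p u 0 j
  - gamma * s_w u * b.
  rewrite /a /b !mulr_sumr -!sumrN -!big_split; apply: eq_bigr => j _ /=.
  by rewrite /fd /flux_deriv; ring.
have -> : gamma * dotp (s_p u) (s_p ut) = gamma * \sum_j s_w (ux j) * s_p u 0 j.
  congr (_ * _); apply: eq_bigr => j _; have := e5 j; move/subr0_eq => ->.
  by rewrite mulrC.
(* The third equation contracted with [q]: this is where the friction term arises. *)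
have <- : tau * dotp (s_q u) (s_q ut) +
    \sum_j (derive1 Pi (s_h u) * s_h (ux j) + s_psi (ux j)) * s_q u 0 j =
    - (sqnorm (s_q u) / M (s_h u)).
  rewrite /sqnorm /dotp mulr_sumr mulr_suml -sumrN -big_split; apply: eq_bigr => j _ /=.
  have := e3 j; move=> e3j.
  transitivity (s_q u 0 j * (tau * s_q ut 0 j + (derive1 Pi (s_h u) * s_h (ux j) + s_psi (ux j)))).
    by ring.
  by rewrite e3j; ring.
have ht : s_h ut = - a by move: e1 => /eqP; rewrite addr_eq0 => /eqP.
have psit : alpha^-1 * s_psi ut = - s_w u - a by rewrite -e2; ring.
have wt : beta * s_w ut = s_psi u + gamma * b by rewrite -e4; ring.
transitivity (Pi (s_h u) * s_h ut + s_psi u * (alpha^-1 * s_psi ut)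
  + s_w u * (beta * s_w ut) + (Pi (s_h u) + s_psi u) * a - gamma * s_w u * b
  + (tau * dotp (s_q u) (s_q ut) +
    \sum_j (derive1 Pi (s_h u) * s_h (ux j) + s_psi (ux j)) * s_q u 0 j)); first by ring.
by rewrite ht psit wt; ring.
Qed.

Variables (T : R) (U : R -> 'rV[R]_d -> 'rV[R]_(sdim d)).
Hypothesis Usol : classical_solution (@state_space R d)
  (hyperbolic_system alpha beta gamma tau M Pi) T U.

Let Uz (z : R * 'rV[R]_d) := U z.1 z.2.
Let A := @slab R d `]0, T[.
Let Ut z := 'D_((1, 0) : R * 'rV[R]_d) Uz z.
Let Ux j z := 'D_((0, basis_vec j) : R * 'rV[R]_d) Uz z.

Let UA : has_C1_deriv_row A Uz (fun v => 'D_v Uz).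
Proof. exact: Ck_on_C1_deriv_row (sol_C1 Usol). Qed.

Let inA t x : 0 < t < T -> A (t, x).
Proof. by move=> tT; rewrite /A /slab /= in_itv. Qed.

(** The equations speak of derivatives of the slices of [U] in time and in space. These are
    identified with the derivatives of the space-time map along [(1, 0)] and [(0, basis_vec j)],
    after which [entropy_identity] is pure algebra. *)
Lemma solution_identity t x : 0 < t < T ->
  dotp (ev (U t x)) (Ut (t, x)) + \sum_j fd j (U t x) (Ux j (t, x)) = - dissipation (U t x).
Proof.
move=> tT; have Atx := inA x tT.
have Dt (f : R * 'rV[R]_d -> R) f' : has_C1_deriv A f f' ->
    'D_1 (fun s => f (s, x)) t = f' (1, 0) (t, x).
  move=> /(_ _ Atx)[_ /(_ (1, 0)) df _].
  have [_ //] := is_derive_line (c := fun s => (s, x)) (fun h => time_line h t x) df.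
have dt (f : R * 'rV[R]_d -> R) f' : has_C1_deriv A f f' ->
    derivable (fun s => f (s, x)) t 1.
  move=> /(_ _ Atx)[_ /(_ (1, 0)) df _].
  by have [] := is_derive_line (c := fun s => (s, x)) (fun h => time_line h t x) df.
have Dx (f : R * 'rV[R]_d -> R) f' j : has_C1_deriv A f f' ->
    'D_(basis_vec j) (fun y => f (t, y)) x = f' (0, basis_vec j) (t, x).
  move=> /(_ _ Atx)[_ /(_ (0, basis_vec j)) df _].
  have [_ //] := is_derive_line (c := fun y => (t, y)) (fun h => space_line h t _ x) df.
have Dvt n (f : R -> 'rV[R]_n) : (forall k, derivable (fun s => f s 0 k) t 1) ->
    forall k, ('D_1 f t) 0 k = 'D_1 (fun s => f s 0 k) t.
  move=> df k; rewrite derive_mx ?mxE//; apply/derivable_mxP => i j; rewrite ord1; exact: df.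
have Dh : 'D_1 (fun s => s_h (U s x)) t = s_h (Ut (t, x)) := Dt _ _ (C1_deriv_s_h UA).
have Dpsi : 'D_1 (fun s => s_psi (U s x)) t = s_psi (Ut (t, x)) := Dt _ _ (C1_deriv_s_psi UA).
have Dw : 'D_1 (fun s => s_w (U s x)) t = s_w (Ut (t, x)) := Dt _ _ (C1_deriv_s_w UA).
have Dq j : 'D_1 (fun s => s_q (U s x)) t 0 j = s_q (Ut (t, x)) 0 j.
  rewrite Dvt; first exact: (Dt _ _ (C1_deriv_s_q UA j)).
  by move=> k; exact: (dt _ _ (C1_deriv_s_q UA k)).
have Dp j : 'D_1 (fun s => s_p (U s x)) t 0 j = s_p (Ut (t, x)) 0 j.
  rewrite Dvt; first exact: (Dt _ _ (C1_deriv_s_p UA j)).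
  by move=> k; exact: (dt _ _ (C1_deriv_s_p UA k)).
have divq : divergence (fun y => s_q (U t y)) x = \sum_j s_q (Ux j (t, x)) 0 j.
  by apply: eq_bigr => j _; exact: (Dx _ _ j (C1_deriv_s_q UA j)).
have divp : divergence (fun y => s_p (U t y)) x = \sum_j s_p (Ux j (t, x)) 0 j.
  by apply: eq_bigr => j _; exact: (Dx _ _ j (C1_deriv_s_p UA j)).
have gradr j : grad (fun y => Pi (s_h (U t y)) + s_psi (U t y)) x 0 j =
    derive1 Pi (s_h (U t x)) * s_h (Ux j (t, x)) + s_psi (Ux j (t, x)).
  rewrite mxE; exact: (Dx _ _ j (C1_derivD (C1_deriv_comp (smooth_is_derive Pi_smooth)
    (smooth_derive1_continuous Pi_smooth) (C1_deriv_s_h UA)) (C1_deriv_s_psi UA))).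
have gradw j : grad (fun y => s_w (U t y)) x 0 j = s_w (Ux j (t, x)).
  by rewrite mxE; exact: (Dx _ _ j (C1_deriv_s_w UA)).
have mxD (a b : 'rV[R]_d) j : (a + b) 0 j = a 0 j + b 0 j by rewrite mxE.
have mxZ c (a : 'rV[R]_d) j : (c *: a) 0 j = c * a 0 j by rewrite mxE.
have mxN (a : 'rV[R]_d) j : (- a) 0 j = - a 0 j by rewrite mxE.
have [e1 e2 e3 e4 e5] := sol_eqn Usol x tT.
apply: entropy_identity.
- by rewrite -divq -Dh.
- by rewrite -divq -Dpsi.
- move=> j; have := congr1 (fun v : 'rV[R]_d => v 0 j) e3.
  by rewrite mxD !mxZ Dq gradr.
- by rewrite -divp -Dw.
- move=> j; have := congr1 (fun v : 'rV[R]_d => v 0 j) e5.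
  by rewrite mxD mxN Dp gradw [RHS]mxE.
Qed.

(** Continuity of [g] is asked on [state_space] only, because [dissipation] divides by [M(h)], which
    is bounded below for [h >= 0]. The solution stays in that set at the end times too. *)
Let Uz_cvg (g : 'rV[R]_(sdim d) -> R) :
  (forall u, state_space u -> {for u, continuous g}) ->
  forall z, slab `[0, T] z -> g (Uz y) @[y --> within (slab `[0, T]) (nbhs z)] --> g (Uz z).
Proof.
move=> cg z Az; have := (subspace_continuousP _ _).1 (sol_continuous Usol) z Az.
apply: continuous_cvg; apply: cg; apply: (sol_range Usol).
by move: Az; rewrite /slab/= in_itv.
Qed.

Let E_cvg := Uz_cvg (fun u _ => let: And3 cE _ _ :=
  entropy_C1_id alpha beta gamma tau Pi_smooth W_Pi (I : setT u) in cE).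

Let cQ j u : {for u, continuous (fun u => Q u 0 j)}.
Proof.
by have [] := entropy_flux_C1 gamma Pi_smooth (@C1_deriv_row_id R (sdim d) setT) j (I : setT u).
Qed.

Let Q_cvg j := Uz_cvg (fun u _ => @cQ j u).

Let D_cvg := Uz_cvg dissipation_continuous.

Let slab_within (g : R * 'rV[R]_d -> R) :
  (forall z, slab `[0, T] z -> g y @[y --> within (slab `[0, T]) (nbhs z)] --> g z) ->
  {within slab `[0, T], continuous g}.
Proof. by move=> cg; apply/subspace_continuousP. Qed.

Let EA := entropy_C1 alpha beta gamma tau Pi_smooth W_Pi UA.
Let QA := entropy_flux_C1 gamma Pi_smooth UA.

Let Q_periodic j t x : 0 < t < T -> Q (U t (x + basis_vec j)) = Q (U t x).
Proof. by move=> /andP[/ltW t0 /ltW tT]; rewrite (sol_periodic Usol)// t0 tT. Qed.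

(* With [phi = 1] this is the energy identity; with a test function, the
   entropy inequality in the sense of distributions. *)
Section weighted_balance.
Variables (phi : R * 'rV[R]_d -> R) (phi' : R * 'rV[R]_d -> R * 'rV[R]_d -> R).
Hypothesis phiA : has_C1_deriv setT phi phi'.
Hypothesis phi_periodic : forall t j x, phi (t, x + basis_vec j) = phi (t, x).

Let g z := E (Uz z) * phi' (1, 0) z + \sum_j Q (Uz z) 0 j * phi' (0, basis_vec j) z.
Let h z := phi z * dissipation (Uz z).

Let cvg_in (f : R * 'rV[R]_d -> R) z : {for z, continuous f} ->
  f y @[y --> within (slab `[0, T]) (nbhs z)] --> f z.
Proof. by move=> cf; exact: cvg_within_filter. Qed.

Let cg : {within slab `[0, T], continuous g}.
Proof.
apply: slab_within => z Az; have [_ _ cphi'] := phiA (I : setT z).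
apply: cvgD.
  by apply: cvgM; [exact: E_cvg|exact: (cvg_in (cphi' (1, 0)))].
apply: cvg_big => [|j _]; first exact: add_continuous.
by apply: cvgM; [exact: Q_cvg|exact: (cvg_in (cphi' (0, basis_vec j)))].
Qed.

Let ch : {within slab `[0, T], continuous h}.
Proof.
apply: slab_within => z Az; have [cphi _ _] := phiA (I : setT z).
by apply: cvgM; [exact: cvg_in|exact: D_cvg].
Qed.

Let cE : {within slab `[0, T], continuous (fun z => E (Uz z) * phi z)}.
Proof.
apply: slab_within => z Az; have [cphi _ _] := phiA (I : setT z).
by apply: cvgM; [exact: E_cvg|exact: cvg_in].
Qed.

Let phiA' : has_C1_deriv A phi phi'.
Proof. by move=> z _; exact: phiA. Qed.

(** The balance law for the density [E phi] and the flux [Q phi]: by the product rule and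
    [solution_identity] its right-hand side is [g - h], in which only [phi] is differentiated. *)
Lemma weighted_energy_balance t : 0 < t <= T ->
  time_integral 0 t (fun s => torus_integral (fun x => g (s, x)))
  - time_integral 0 t (fun s => torus_integral (fun x => h (s, x))) =
  torus_integral (fun x => E (U t x) * phi (t, x))
  - torus_integral (fun x => E (U 0 x) * phi (0, x)).
Proof.
move=> tT; have EphiA := C1_derivM EA phiA'.
have QphiA j := C1_derivM (QA j) phiA'.
rewrite -(@space_time_integralB R d T t _ g h cg ch); last first.
  by case/andP: tT => /ltW -> ->.
apply: (@balance_integral R d T (fun z => E (Uz z) * phi z)
  (fun z => dotp (ev (Uz z)) (Ut z) * phi z + E (Uz z) * phi' (1, 0) z) (fun z => g z - h z)
  (fun j z => Q (Uz z) 0 j * phi z)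
  (fun j z => fd j (Uz z) (Ux j z) * phi z + Q (Uz z) 0 j * phi' (0, basis_vec j) z)) => //.
- apply: slab_within => z Az; apply: cvgB.
    exact: (subspace_continuousP _ _).1 cg z Az.
  exact: (subspace_continuousP _ _).1 ch z Az.
- by move=> s x sT; have [_ H _] := EphiA _ (inA x sT); exact: (H (1, 0)).
- by move=> s x sT; have [_ _ H] := EphiA _ (inA x sT); exact: (H (1, 0)).
- by move=> j s x sT; have [_ H _] := QphiA j _ (inA x sT); exact: (H (0, basis_vec j)).
- by move=> j s x sT; have [_ _ H] := QphiA j _ (inA x sT); exact: (H (0, basis_vec j)).
- by move=> j s x sT; rewrite phi_periodic /Uz/= Q_periodic.
- move=> s x sT /=; rewrite big_split/= -mulr_suml /g /h /Uz /=.
  rewrite addrACA -mulrDl addrC; have := solution_identity x sT.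
  by rewrite /Uz => ->; ring.
Qed.

End weighted_balance.

Lemma energy_balance t : 0 < t <= T ->
  torus_integral (fun x => E (U t x))
  + time_integral 0 t (fun s => torus_integral (fun x => dissipation (U s x)))
  = torus_integral (fun x => E (U 0 x)).
Proof.
move=> tT.
have := @weighted_energy_balance _ _ (@C1_deriv_cst R _ setT 1) (fun _ _ _ => erefl) t tT.
(* For the constant weight all derivatives of [phi] vanish, and with them the integral of [g]. *)
rewrite [X in X - _](_ : _ = 0); last first.
  rewrite /time_integral /torus_integral /Rintegral.
  have z0 s x : E (U s x) * 0 + \sum_j Q (U s x) 0 j * 0 = 0.
    by rewrite mulr0 add0r big1// => j _; rewrite mulr0.
  under eq_integral do under eq_integral do rewrite z0.
  by under eq_integral do rewrite integral0/=; rewrite integral0.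
under [X in 0 - X]eq_Rintegral do under [X in torus_integral X]eq_fun do rewrite mul1r.
under [X in torus_integral X]eq_fun do rewrite mulr1.
under [X in _ - torus_integral X]eq_fun do rewrite mulr1.
rewrite sub0r => H.
have {}H : - time_integral 0 t (fun s => torus_integral (fun x => dissipation (U s x))) =
  torus_integral (fun x => E (U t x)) - torus_integral (fun x => E (U 0 x)) := H.
lra.
Qed.

(** A test function vanishes at times [0] and [T], so the boundary terms of the weighted balance
    drop out. The distributional pairing then equals the integral of [phi] times the dissipation, a
    product of nonnegative functions. *)
Lemma weak_inequality : 0 < T -> weak_entropy_inequality E Q T U.
Proof.
move=> T0 phi [phi_smooth phi_per [a [b [a0 bT phi_supp]]] phi_ge0].
pose phiz (z : R * 'rV[R]_d) := phi z.1 z.2.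
have phiA : has_C1_deriv setT phiz (fun v => 'D_v phiz).
  exact: Ck_on_C1_deriv (phi_smooth 1%N).
have phi_out t x : ~~ (a <= t <= b) -> phi t x = 0.
  by move=> tab; apply/eqP; apply: contraNT tab; exact: phi_supp.
have phi00 x : phi 0 x = 0 by apply: phi_out; rewrite leNgt a0.
have phiT0 x : phi T x = 0 by apply: phi_out; rewrite negb_and -!ltNge bT orbT.
have := @weighted_energy_balance _ _ phiA (fun t j x => phi_per t x j) T.
rewrite T0 lexx => /(_ isT).
have t0 (f : 'rV[R]_d -> R) : (forall x, f x = 0) -> torus_integral f = 0.
  move=> f0; rewrite /torus_integral /Rintegral.
  by under eq_integral do rewrite f0; rewrite integral0.
rewrite (t0 (fun x => E (U T x) * _)); last by move=> x; rewrite /phiz/= phiT0 mulr0.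
rewrite (t0 (fun x => E (U 0 x) * _)); last by move=> x; rewrite /phiz/= phi00 mulr0.
rewrite subrr => /subr0_eq H.
have Dt t x : 'D_1 (phi ^~ x) t = 'D_((1, 0) : R * 'rV[R]_d) phiz (t, x).
  have [_ /(_ (1, 0)) df _] := phiA (t, x) I.
  by have [_ ->] := is_derive_line (c := fun s => (s, x)) (fun h => time_line h t x) df.
have Dx t x j : grad (phi t) x 0 j = 'D_((0, basis_vec j) : R * 'rV[R]_d) phiz (t, x).
  have [_ /(_ (0, basis_vec j)) df _] := phiA (t, x) I; rewrite mxE.
  by have [_ ->] := is_derive_line (c := fun y => (t, y)) (fun h => space_line h t _ x) df.
rewrite [leRHS](_ : _ = time_integral 0 T (fun s => torus_integral (fun x =>
    phi s x * dissipation (U s x)))); last first.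
  rewrite -H; apply: eq_Rintegral => t _; congr torus_integral; apply/funext => x.
  by rewrite Dt /dotp; congr (_ + _); apply: eq_bigr => j _; rewrite Dx.
apply: Rintegral_ge0 => t; rewrite /= in_itv/= => tT.
apply: Rintegral_ge0 => x _; rewrite mulr_ge0// dissipation_ge0//.
exact: sol_range Usol _ _ tT.
Qed.

End solutions.
Theorem lemma2p1 (R : realType) (d : nat)
    (alpha beta gamma tau L m0 delta : R) (M Pi W : R -> R)
    (alpha_gt0 : 0 < alpha) (beta_gt0 : 0 < beta)
    (gamma_gt0 : 0 < gamma) (tau_gt0 : 0 < tau)
    (L_gt0 : 0 < L) (m0_gt0 : 0 < m0) (delta_gt0 : 0 < delta)
    (M_ge0 : forall h : R, 0 <= M h) (M_smooth : smooth M) (Pi_smooth : smooth Pi)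
    (M'_lt : forall h : R, 0 <= h -> `|derive1 M h| < L)
    (M_gt : forall h : R, 0 <= h -> m0^-1 < M h)
    (Pi'_lt : forall h : R, 0 <= h -> `|derive1 Pi h| < L)
    (Pi''_lt : forall h : R, 0 <= h -> `|derive1n 2 Pi h| < L)
    (Pi'_ge : forall h : R, 0 <= h -> delta <= derive1 Pi h)
    (W_Pi : forall h : R, is_derive h 1 W (Pi h)) :
  let E := entropy (d := d) alpha beta gamma tau W in
  let Q := entropy_flux (d := d) gamma Pi in
  [/\ entropy_pair state_space (flux alpha beta gamma tau Pi)
        (source alpha beta tau M) E Q,
      strictly_convex_on state_space E &
      forall (T : R) (U : R -> 'rV[R]_d -> 'rV[R]_(sdim d))
        (U0 : 'rV[R]_d -> 'rV[R]_(sdim d)),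
        0 < T ->
        classical_solution state_space
          (hyperbolic_system alpha beta gamma tau M Pi) T U ->
        (forall x, U 0 x = U0 x) ->
        forall t : R, 0 < t <= T ->
          torus_integral (fun x => E (U t x))
          + time_integral 0 t (fun s => torus_integral (fun x =>
              sqnorm (s_q (U s x)) / M (s_h (U s x))))
          = torus_integral (fun x => E (U0 x))].
Proof.
move=> E Q; split.
- split.
  + exact: entropy_Ck.
  + exact: entropy_flux_Ck.
  + exact: (entropy_convex_function alpha_gt0 beta_gt0 gamma_gt0 tau_gt0 delta_gt0).
  + move=> u Gu.
    exact: (hessian_posdef alpha_gt0 beta_gt0 gamma_gt0 tau_gt0 delta_gt0 Pi_smooth W_Pi).
  + by move=> u j _; apply: flux_compat => //; exact: lt0r_neq0.
  (* The entropy inequality is demanded along solutions in balance-law form, whereas the energy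
     computation uses the equations in their original form. *)
  + move=> T U T_gt0 /(classical_solution_hyperbolic_system gamma M T U alpha_gt0 beta_gt0
      tau_gt0 Pi_smooth) Usol.
    exact: (weak_inequality m0_gt0 M_smooth M_gt Pi_smooth W_Pi Usol T_gt0).
- exact: (entropy_strictly_convex alpha_gt0 beta_gt0 gamma_gt0 tau_gt0 delta_gt0).
- move=> T U U0 T_gt0 Usol UU0 t tT.
  rewrite -(funext UU0).
  exact: (energy_balance m0_gt0 M_smooth M_gt Pi_smooth W_Pi Usol tT).
Qed.
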